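(* The complexity of (1,2)Insertion$^*$ is at most $n\lg n -1.4034n$.
   Context: Complexity means the expected number of comparisons over all $n!$ orderings of $n$ distinct input elements; $n$ even, $O(\log n)$ terms ignored. $\lg=\log_2$, $p_x = x/2^{\lceil \lg x\rceil}$. RHBS$(A,T)$, $T=(t_1,\dots,t_i)$ sorted: if $i\le 3\cdot 2^{\lceil\lg(i+1)\rceil-2}-1$ let $d=2^{\lceil\lg(i+1)\rceil-2}$, else $d=i-2^{\lceil\lg(i+1)\rceil-1}+1$; compare $A$ with $t_d$ and recurse on the left or right part. 2Merge$^*(A,B,T)$, $T=(t_1,\dots,t_{i-2})$ sorted, $i$ even $\ge4$: Step 1 compare and swap so $A<B$. Step 2: for $r=1,2,\dots$ up to $2\lg i$ compare $A$ with $t_{\lceil\alpha(r,p_i)i\rceil}$, stopping at the first $r$ with $A<t_{\lceil\alpha(r,p_i)i\rceil}$, where for $r=2k-1$: $\alpha=1-2^{-(k-1)}+\frac{1}{p_i2^{k+1}}$ if $p_i\in(3/4,1]$ and $\alpha=1-2^{-k}-\frac{1}{p_i2^{k+2}}$ if $p_i\in(1/2,3/4]$; for $r=2k$: $\alpha=1-2^{-k}$. Step 3: insert $A$ into $(t_{\lceil\alpha(r-1,p_i)i\rceil+1},\dots,t_{\lceil\alpha(r,p_i)i\rceil-1})$ by RHBS, say between $t_\ell,t_{\ell+1}$. Step 4: insert $B$ into $(t_{\ell+1},\dots,t_{i-2})$ by RHBS. (1,2)Insertion$^*(S)$, $S=(s_1,\dots,s_n)$, $n$ even: if $n=2$ sort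 with one comparison; otherwise sort $(s_1,\dots,s_{n-2})$ recursively to get $T'$; if $p_n\in[\frac34-\frac{\sqrt6}{12},\frac34+\frac{\sqrt3}{12}]$ insert $s_{n-1},s_n$ by 2Merge$^*(s_{n-1},s_n,T')$, otherwise insert $s_{n-1}$ and then $s_n$ by RHBS. *)

(* Defs.v *)
From HB Require Import structures.
From mathcomp Require Import all_boot all_order all_algebra.
From mathcomp Require Import reals exp.
Set Implicit Arguments. Unset Strict Implicit. Unset Printing Implicit Defensive.
Import Order.TTheory GRing.Theory Num.Theory.

(* Elements to be sorted are natural numbers (distinct), compared with [<]. *)

Definition clg (x : nat) : nat := up_log 2 x.

Definition ins_at (a : nat) (l : nat) (T : seq nat) : seq nat :=
  take l T ++ a :: drop l T.

(* pivot index d (1-based) for a sorted list of length i >= 1 *)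
Definition rhbs_d (i : nat) : nat :=
  let k := clg i.+1 in
  (* i <= 3 * 2^(k-2) - 1  <->  4 (i+1) <= 3 * 2^k *)
  if 4 * i.+1 <= 3 * 2 ^ k then 2 ^ (k - 2) else i.+1 - 2 ^ (k - 1).

(* returns (l, c): a is inserted between t_l and t_(l+1); c = #comparisons *)
Fixpoint rhbs_aux (fuel : nat) (a : nat) (T : seq nat) : nat * nat :=
  match fuel with
  | 0 => (0, 0)
  | f.+1 =>
    if T is [::] then (0, 0) else
    let d := rhbs_d (size T) in
    if a < nth 0 T d.-1 then
      let: (l, c) := rhbs_aux f a (take d.-1 T) in (l, c.+1)
    else
      let: (l, c) := rhbs_aux f a (drop d T) in (d + l, c.+1)
  end.

Definition rhbs (a : nat) (T : seq nat) : nat * nat := rhbs_aux (size T) a T.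

Section WithReals.
Local Open Scope ring_scope.
Variable R : realType.

Definition pp (x : nat) : R := x%:R / (2 ^ clg x)%:R.

Definition alpha (r : nat) (p : R) : R :=
  if odd r then
    let k := r.+1./2 in
    if 3 / 4 < p then 1 - 2 ^- (k - 1) + 1 / (p * 2 ^+ k.+1)
    else 1 - 2 ^- k - 1 / (p * 2 ^+ k.+2)
  else let k := r./2 in (* r = 2k *) 1 - 2 ^- k.

Definition midx (i r : nat) : nat := absz (Num.ceil (alpha r (pp i) * i%:R)).

(* Step 2 search, starting at r; returns (stopping r, #comparisons).
   t_j with j > i-2 is treated as +infinity (no comparison made). *)
Fixpoint msearch (fuel : nat) (i : nat) (a : nat) (T : seq nat) (r : nat)
  : nat * nat :=
  match fuel with
  | 0 => (r, 0)
  | f.+1 =>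
    if (i - 2 < midx i r)%N then (r, 0)
    else if (a < nth 0 T (midx i r).-1)%N then (r, 1%N)
    else let: (r', c) := msearch f i a T r.+1 in (r', c.+1)
  end.

Definition merge2 (A B : nat) (T : seq nat) : seq nat * nat :=
  let i := (size T + 2)%N in
  let: (a, b) := if (A < B)%N then (A, B) else (B, A) in
  (* Step 2: r = 1, 2, ... up to 2 lg i, i.e. while 2^r <= i^2 *)
  let: (r, c2) := msearch (trunc_log 2 (i * i)) i a T 1 in
  let lo := midx i r.-1 in
  let hi := minn (midx i r).-1 (i - 2) in
  let: (l', c3) := rhbs a (take (hi - lo) (drop lo T)) in
  let l := (lo + l')%N in
  let: (l2, c4) := rhbs b (drop l T) in
  (ins_at b (l + l2).+1 (ins_at a l T), (1 + c2 + c3 + c4)%N).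

Definition use_merge (n : nat) : bool :=
  (3 / 4 - Num.sqrt 6 / 12 <= pp n) && (pp n <= 3 / 4 + Num.sqrt 3 / 12).

(* (1,2)Insertion* applied to the first 2m elements of S;
   returns (sorted list, #comparisons) *)
Fixpoint ins12 (m : nat) (S : seq nat) : seq nat * nat :=
  match m with
  | 0 => ([::], 0%N)
  | 1 => let x := nth 0 S 0 in let y := nth 0 S 1 in
         (if (x < y)%N then [:: x; y] else [:: y; x], 1%N)
  | m'.+1 =>
    let: (T', c) := ins12 m' S in
    let n := (2 * m)%N in
    let x := nth 0 S (n - 2) in
    let y := nth 0 S (n - 1) in
    if use_merge n then
      let: (T'', c') := merge2 x y T' in (T'', (c + c')%N)
    else
      let: (l1, c1) := rhbs x T' in
      let T1 := ins_at x l1 T' in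
      let: (l2, c2) := rhbs y T1 in
      (ins_at y l2 T1, (c + c1 + c2)%N)
  end.

Definition total_comps (n : nat) : nat :=
  sumn [seq (ins12 n./2 s).2 | s <- permutations (iota 0 n)].

Definition complexity (n : nat) : R := (total_comps n)%:R / (n`!)%:R.

Definition lg (x : R) : R := ln x / ln 2.

End WithReals.

(* Main.v *)
(* Insert pairs into a sorted list of N - 2 elements, with K = clg N and
   p = N / 2 ^ K.  RHBS is a search tree with L leaves of depth clg L or
   clg L - 1, the shallow leaves coming first, so its cost is determined by the
   rank of the inserted element, and these ranks are uniform.  In 2Merge, the
   breakpoints alpha are such that one of the two gaps of every round is an exact
   power of 2, hence the cost of the smaller element is an explicit step function
   whose steps shrink by a factor 2 from one round to the next.  Up to O(1 / N),
   a pair then costs 2 K + g(p) on average, where g is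
     g1 = 2 - 2/p                      without merging,
     g2 = 3 - 7/(2p) + 25/(48p^2)      with merging and p <= 3/4,
     g3 = 4 - 5/p + 13/(12p^2)         with merging and 3/4 < p,
   and the thresholds 3/4 - sqrt 6/12, 3/4 + sqrt 3/12 are the points where
   merging stops being cheaper.  Since the algorithm picks the cheaper option,
   each of these functions bounds the cost of its range of p, so the thresholds can
   be replaced by the dyadic points 35/64 and 57/64.  Antiderivatives of g1, g2,
   g3, g1 on the pieces cut at 35/64, 3/4, 57/64, glued with rational constants,
   give a potential that dominates the total cost; it is compared with
   n lg n - 1.4034 n by rational bounds on ln (the minimum of the constant is
   1.40342, near p = 0.904). *)
Require Import Defs.
From HB Require Import structures.
From mathcomp Require Import all_boot all_order all_algebra.
From mathcomp Require Import boolp classical_sets functions set_interval reals.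
From mathcomp Require Import topology normedtype derive realfun exp.
From mathcomp Require Import zify ring lra.
Import Order.TTheory GRing.Theory Num.Theory.

(** * Right-heavy binary search *)

(** A list of [L - 1] elements has [L] insertion positions, the leaves of the search tree. The first
    [2 ^ clg L - L] leaves are the shallow ones, and the boolean subtracts 1 for them. *)
Definition dep (L j : nat) : nat := clg L - (j < 2 ^ clg L - L).

Lemma clgP (L k : nat) : 2 ^ k < L <= 2 ^ k.+1 -> clg L = k.+1.
Proof. exact: up_log_eq. Qed.

Lemma clg_pow2 (k : nat) : clg (2 ^ k) = k.
Proof. exact: up_expnK. Qed.

Lemma clg_bounds (L : nat) : 1 < L -> exists k, clg L = k.+1 /\ 2 ^ k < L <= 2 ^ k.+1.
Proof.
move=> L1; have := @up_log_bounds 2 L isT L1; rewrite -/(clg L).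
by case: (clg L) => [|k] /= H; [lia | exists k].
Qed.

Lemma dep_pow2 (k j : nat) : dep (2 ^ k) j = k.
Proof. by rewrite /dep clg_pow2 subnn ltn0 subn0. Qed.

Lemma rhbs_d_bounds (L : nat) : 1 < L -> 0 < rhbs_d L.-1 < L.
Proof.
move=> L1; have [k [Ek /andP[kL Lk]]] := clg_bounds _ L1.
rewrite /rhbs_d (ltn_predK L1) Ek subn1.
case: k kL Lk {Ek} => [|k] kL Lk.
  by case: ifP; rewrite expn0; lia.
rewrite subn2 /=; move: kL Lk; rewrite !expnS.
by have : 0 < 2 ^ k by [rewrite expn_gt0]; case: ifP; lia.
Qed.

(** With [K = clg L], the pivot always makes one part a complete tree. If [4 L <= 3 * 2 ^ K], the
    left part has [2 ^ (K - 2)] leaves, all shallow in the whole tree; otherwise the right part has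
    [2 ^ (K - 1)] leaves, all deep. The other part keeps its shallow leaves first. *)
Lemma dep_rec (L j : nat) : 1 < L -> j < L ->
  dep L j = (let d := rhbs_d L.-1 in
             if j < d then dep d j else dep (L - d) (j - d)).+1.
Proof.
move=> L1 jL; have [k [Ek /andP[kL Lk]]] := clg_bounds _ L1.
rewrite /rhbs_d (ltn_predK L1) Ek subn1 subn2 /=.
case: k kL Lk Ek => [|k] kL Lk Ek.
  have -> : L = 2 by move: kL Lk; rewrite expn1; lia.
  by rewrite /dep /=; case: ifP => _.
rewrite /=.
have k0 : 0 < 2 ^ k by rewrite expn_gt0.
case: (leqP (4 * L)) => /= c1.
  have E2 : clg (L - 2 ^ k) = k.+1 by apply: clgP; move: kL Lk c1; rewrite !expnS; lia.
  case: ifP => c2.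
    rewrite dep_pow2 /dep Ek.
    by move: kL Lk c1 c2; rewrite !expnS; lia.
  rewrite /dep E2 Ek.
  by move: kL Lk c1 c2; rewrite !expnS; lia.
have E2 : clg (L - 2 ^ k.+1) = k.+1 by apply: clgP; move: kL Lk c1; rewrite !expnS; lia.
case: ifP => c2.
  rewrite /dep E2 Ek.
  by move: kL Lk c1 c2; rewrite !expnS; lia.
have -> : L - (L - 2 ^ k.+1) = 2 ^ k.+1 by lia.
rewrite dep_pow2 /dep Ek.
by move: kL Lk c1 c2; rewrite !expnS; lia.
Qed.

Definition rank (a : nat) (T : seq nat) : nat := count (fun t => t < a) T.

(** A comparison with an entry of a sorted list depends on [a] only through its rank. This is what
    turns every search into a function of ranks. *)
Lemma ltn_nth_rank (a m : nat) (T : seq nat) :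
  sorted ltn T -> a \notin T -> m < size T -> (a < nth 0 T m) = (rank a T <= m).
Proof.
move=> sT aT mT; rewrite /rank.
have sz : size (take m T) = m by rewrite size_takel // ltnW.
have nthE := cat_take_drop m T.
have dE := drop_nth 0 mT.
have sT' : sorted ltn (take m T ++ nth 0 T m :: drop m.+1 T).
  by rewrite -dE nthE.
have nt : nth 0 T m != a by apply: contraNneq aT => <-; exact: mem_nth.
move: sT'; rewrite (sorted_pairwise ltn_trans) pairwise_cat /= => /and4P[allr _ dl _].
rewrite -{2}nthE dE count_cat /=.
have [anth|] := ltnP a (nth 0 T m).
  rewrite ltnNge (ltnW anth) /= add0n.
  suff -> : count (fun t => t < a) (drop m.+1 T) = 0.
    by rewrite addn0 -{2}sz; apply/esym/count_size.
  apply/eqP; rewrite -leqn0 leqNgt -has_count; apply/hasPn => t /(allP dl) /= H.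
  by rewrite -leqNgt ltnW // (ltn_trans anth).
rewrite leq_eqVlt (negPf nt) /= => ntha.
rewrite ntha.
suff -> : count (fun t => t < a) (take m T) = m by lia.
rewrite -[RHS]sz; apply/eqP; rewrite -all_count; apply/allP => t tT.
apply: ltn_trans ntha.
by move/allrelP: allr => /(_ t (nth 0 T m) tT); apply; rewrite inE eqxx.
Qed.

Lemma rank_size (a : nat) (T : seq nat) : rank a T <= size T.
Proof. exact: count_size. Qed.

Lemma rank_take (a d : nat) (T : seq nat) :
  sorted ltn T -> a \notin T -> rank a T <= d -> rank a (take d T) = rank a T.
Proof.
move=> sT aT rd; rewrite -[in RHS](cat_take_drop d T) /rank count_cat.
suff -> : count (fun t => t < a) (drop d T) = 0 by rewrite addn0.
apply/eqP; rewrite -leqn0 leqNgt -has_count; apply/hasPn => t.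
case/(nthP 0) => i; rewrite size_drop nth_drop => iT <-.
rewrite -leqNgt ltnW // ltn_nth_rank ?(leq_trans rd) ?leq_addr //.
by rewrite -ltn_subRL.
Qed.

Lemma rank_drop (a d : nat) (T : seq nat) :
  sorted ltn T -> a \notin T -> d <= rank a T -> rank a (drop d T) = rank a T - d.
Proof.
move=> sT aT dr; rewrite -[in RHS](cat_take_drop d T) /rank count_cat.
have dT : d <= size T by apply: leq_trans dr (rank_size _ _).
suff -> : count (fun t => t < a) (take d T) = d by rewrite addKn.
rewrite -[RHS](size_takel dT); apply/eqP; rewrite -all_count; apply/allP => t.
case/(nthP 0) => i; rewrite size_takel // => iT <-; rewrite nth_take //.
have iT' : i < size T by lia.
rewrite ltn_neqAle; apply/andP; split.
  by apply: contraNneq aT => <-; exact: mem_nth.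
by rewrite leqNgt ltn_nth_rank //; lia.
Qed.

Lemma rhbs_auxE (f a : nat) (T : seq nat) :
  sorted ltn T -> a \notin T -> size T <= f ->
  rhbs_aux f a T = (rank a T, dep (size T).+1 (rank a T)).
Proof.
elim: f T => [|f IH] T sT aT Tf.
  by move: Tf; rewrite leqn0 size_eq0 => /eqP ->.
rewrite /=; case E : T => [|t0 T0] //; rewrite -E.
have sz : 0 < size T by rewrite E.
have L1 : 1 < (size T).+1 by [].
have := rhbs_d_bounds _ L1; rewrite [_.+1.-1]/= => /andP[d0 dT].
set d := rhbs_d (size T) in d0 dT *.
have rT := rank_size a T.
rewrite ltn_nth_rank //; last by lia.
rewrite [in RHS]dep_rec // [_.+1.-1]/= -/d /=.
have -> : (rank a T <= d.-1) = (rank a T < d) by lia.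
case: ifP => c.
  rewrite IH ?take_sorted //; first last.
  - by rewrite size_takel //; lia.
  - by apply: contra aT => /mem_take.
  rewrite rank_take // ?size_takel; [|lia|lia].
  by rewrite prednK.
rewrite IH ?drop_sorted //; first last.
- by rewrite size_drop; lia.
- by apply: contra aT => /mem_drop.
rewrite rank_drop //; [|lia].
by rewrite size_drop subSn; [congr pair; lia|lia].
Qed.

Lemma rhbsE (a : nat) (T : seq nat) : sorted ltn T -> a \notin T ->
  rhbs a T = (rank a T, dep (size T).+1 (rank a T)).
Proof. by move=> sT aT; apply: rhbs_auxE. Qed.

(** External path length of the search tree: [L] leaves at depth [clg L], less one for each of the
    [2 ^ clg L - L] shallow ones. *)
Definition path_len (L : nat) : nat := L * (clg L).+1 - 2 ^ clg L.

Lemma pow2_clg_le (L : nat) : 0 < L -> L <= 2 ^ clg L <= L.*2.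
Proof.
case: L => [//|[_|L _]]; first by rewrite /clg up_log1.
have [k [-> ]] := clg_bounds L.+2 isT; rewrite !expnS; lia.
Qed.

Lemma clg_gt0 (L : nat) : 1 < L -> 0 < clg L.
Proof. by move=> L1; have [k [-> _]] := clg_bounds _ L1. Qed.

Lemma sum_dep (L : nat) : 0 < L -> \sum_(0 <= j < L) dep L j = path_len L.
Proof.
move=> L0; have /andP[kL Lk] := pow2_clg_le _ L0.
have [->|L1] : L = 1 \/ 1 < L by lia.
  by rewrite big_nat1 /dep /path_len /clg up_log1.
rewrite /path_len; have := clg_gt0 _ L1.
rewrite /dep; set k := clg L in kL Lk * => k0.
have sL : 2 ^ k - L <= L by lia.
rewrite (big_cat_nat (leq0n _) sL) /=.
rewrite (eq_big_nat _ _ (F2 := fun=> k - 1)); last first.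
  by move=> j /andP[_ ->].
rewrite [X in _ + X](eq_big_nat _ _ (F2 := fun=> k)); last first.
  by move=> j /andP[jL _]; rewrite ltnNge jL subn0.
by rewrite !sum_nat_const_nat; nia.
Qed.

(** * Correctness of 2Merge *)

Lemma perm_ins_at (a l : nat) (T : seq nat) : perm_eq (ins_at a l T) (a :: T).
Proof. by rewrite -[X in _ :: X](cat_take_drop l T) /ins_at perm_catC /= perm_cons perm_catC. Qed.

Lemma take_rank_lt (a t : nat) (T : seq nat) : sorted ltn T -> a \notin T ->
  t \in take (rank a T) T -> t < a.
Proof.
move=> sT aT tT; have := rank_take a (rank a T) _ sT aT (leqnn _).
rewrite {1}/rank -[RHS](@size_takel (rank a T) _ T) ?rank_size // => /eqP.
by rewrite -all_count => /allP /(_ t tT).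
Qed.

Lemma drop_rank_gt (a t : nat) (T : seq nat) : sorted ltn T -> a \notin T ->
  t \in drop (rank a T) T -> a < t.
Proof.
move=> sT aT tT; have := rank_drop a (rank a T) _ sT aT (leqnn _).
rewrite subnn {1}/rank => /eqP; rewrite -leqn0 leqNgt -has_count => /hasPn /(_ t tT).
by rewrite -leqNgt leq_eqVlt; case: eqP aT => // ->; rewrite (mem_drop tT).
Qed.

Lemma sorted_ins_at (a : nat) (T : seq nat) : sorted ltn T -> a \notin T ->
  sorted ltn (ins_at a (rank a T) T).
Proof.
move=> sT aT; move: (sT); rewrite -{1}(cat_take_drop (rank a T) T) /ins_at.
rewrite !(sorted_pairwise ltn_trans) !pairwise_cat /= => /and3P[tr -> ->].
rewrite andbT /=; apply/andP; split.
  rewrite allrel_consr; apply/andP; split=> //.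
  by apply/allP => t; exact: take_rank_lt.
by apply/allP => t; exact: drop_rank_gt.
Qed.

Lemma rank_cons (b a : nat) (T : seq nat) : rank b (a :: T) = (a < b) + rank b T.
Proof. by []. Qed.

Lemma perm_rank (b : nat) (S T : seq nat) : perm_eq S T -> rank b S = rank b T.
Proof. by move/permP; apply. Qed.

Lemma leq_rank (a b : nat) (T : seq nat) : a <= b -> rank a T <= rank b T.
Proof. by move=> ab; apply: sub_count => t /= ta; exact: leq_trans ab. Qed.

Section Search.
Variable R : realType.

(** [msearch] with the element and the list replaced by the rank [g]. An index beyond [i - 2] ends
    the search without a comparison, hence the boolean count of the last round. *)
Fixpoint gsearch (f i g r : nat) : nat * nat :=
  if f is f'.+1 then
    if g < midx R i r then (r, nat_of_bool (midx R i r <= i - 2))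
    else let: (r', c) := gsearch f' i g r.+1 in (r', c.+1)
  else (r, 0).

Lemma msearchE (f i a r : nat) (T : seq nat) :
  sorted ltn T -> a \notin T -> size T = i - 2 ->
  (forall q, 0 < q -> 0 < midx R i q) -> 0 < r ->
  msearch R f i a T r = gsearch f i (rank a T) r.
Proof.
move=> sT aT Ti mpos; elim: f r => [|f IH] r r0 //=.
have rT := rank_size a T.
have := mpos r r0; set m := midx R i r => m0.
case: (ltnP (i - 2) m) => im.
  by rewrite ifT //; lia.
rewrite ltn_nth_rank //; last by rewrite Ti; lia.
have -> : (rank a T <= m.-1) = (rank a T < m) by lia.
by rewrite IH.
Qed.

(** The hypothesis says that some index within the fuel exceeds [g], so the search ends by a genuine
    stop and not by running out of fuel. *)
Lemma gsearchP (f i g r : nat) :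
  (exists2 s, s < f & g < midx R i (r + s)) ->
  [/\ r <= (gsearch f i g r).1 < r + f,
      (gsearch f i g r).2 <= (gsearch f i g r).1.+1 - r,
      g < midx R i (gsearch f i g r).1 &
      forall q, r <= q < (gsearch f i g r).1 -> midx R i q <= g].
Proof.
elim: f r => [|f IH] r [s sf gs] //=.
case: (ltnP g (midx R i r)) => gr /=.
  split=> //.
  - by rewrite leqnn -addn1 leq_add2l.
  - by rewrite subSnn leq_b1.
  - by move=> q /andP[rq qr]; move: rq; rewrite leqNgt qr.
have ex : exists2 s, s < f & g < midx R i (r.+1 + s).
  case: s sf gs => [|s] sf gs; first by move: gs; rewrite addn0 ltnNge gr.
  by exists s => //; rewrite addSnnS.
have := IH r.+1 ex; case: (gsearch f i g r.+1) => r' c /= [h1 h2 h3 h4].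
split=> //; try lia.
move=> q; case: (eqVneq q r) => [-> //|qr] h; apply: h4; lia.
Qed.

(* Comparisons spent on the smaller element, when it has [g] predecessors
   among the [i - 2] elements already sorted. *)
Definition cost_small (i g : nat) : nat :=
  let: (r, c) := gsearch (trunc_log 2 (i * i)) i g 1 in
  let lo := midx R i r.-1 in
  let hi := minn (midx R i r).-1 (i - 2) in
  c + dep (hi - lo).+1 (g - lo).

Lemma merge2E (i A B : nat) (T : seq nat) :
  1 < i -> sorted ltn T -> A \notin T -> B \notin T -> A != B -> size T = i - 2 ->
  (forall q, 0 < q -> 0 < midx R i q) -> midx R i 0 = 0 ->
  i - 2 < midx R i (trunc_log 2 (i * i)) -> 0 < trunc_log 2 (i * i) ->
  let ga := minn (rank A T) (rank B T) in
  let gb := maxn (rank A T) (rank B T) in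
  [/\ sorted ltn (merge2 R A B T).1, perm_eq (merge2 R A B T).1 [:: A, B & T] &
   (merge2 R A B T).2 = 1 + cost_small i ga + dep (i - 1 - ga) (gb - ga)].
Proof.
move=> i1 sT; rewrite /merge2.
wlog AB : A B / A < B => [hw|] AT BT neq Ti mpos m0 mtop F0.
  have [lt|gt|eq] := ltngtP A B; last by rewrite eq eqxx in neq.
    by have := hw A B lt AT BT neq Ti mpos m0 mtop F0; rewrite lt.
  have := hw B A gt BT AT _ Ti mpos m0 mtop F0.
  rewrite eq_sym => /(_ neq); rewrite gt minnC maxnC => -[h1 h2 h3]; split=> //.
  by rewrite (perm_trans h2) // (perm_catCA [:: B] [:: A]).
have rAB := leq_rank _ _ T (ltnW AB).
rewrite AB Ti subnK // (minn_idPl rAB) (maxn_idPr rAB) /=.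
rewrite msearchE // /cost_small.
have rT := rank_size A T.
have ex : exists2 s, s < trunc_log 2 (i * i) & rank A T < midx R i (1 + s).
  by exists (trunc_log 2 (i * i)).-1; [lia | rewrite add1n prednK //; lia].
have [] := gsearchP _ _ _ _ ex.
case: (gsearch _ i _ _) => r c /= h1 h2 h3 h4.
set lo := midx R i r.-1; set hi := minn (midx R i r).-1 (i - 2).
have lor : lo <= rank A T.
  rewrite /lo; case: (posnP r.-1) => [->|r0]; first by rewrite m0.
  by apply: h4; lia.
have hir : rank A T <= hi by rewrite /hi; lia.
have hiT : hi <= size T by rewrite /hi; lia.
have sd : sorted ltn (drop lo T) by rewrite drop_sorted.
have Ad : A \notin drop lo T by apply: contra AT => /mem_drop.
rewrite rhbsE ?take_sorted //; last by apply: contra Ad => /mem_take.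
have rd : rank A (drop lo T) = rank A T - lo by rewrite rank_drop.
rewrite rank_take ?rd //; last by lia.
rewrite subnKC // size_takel ?size_drop; last by lia.
rewrite rhbsE ?drop_sorted //; last by apply: contra BT => /mem_drop.
rewrite rank_drop // size_drop Ti subnKC //=.
have AiT : sorted ltn (ins_at A (rank A T) T) by exact: sorted_ins_at.
have pA := perm_ins_at A (rank A T) T.
have BiT : B \notin ins_at A (rank A T) T.
  by rewrite (perm_mem pA) inE negb_or eq_sym neq.
have rB : rank B (ins_at A (rank A T) T) = (rank B T).+1.
  by rewrite (perm_rank _ _ _ pA) rank_cons AB.
split.
- by rewrite -rB sorted_ins_at.
- apply: perm_trans (perm_ins_at _ _ _) _; apply: (@perm_trans _ [:: B, A & T]).
    by rewrite perm_cons.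
  by rewrite (perm_catCA [:: B] [:: A]).
- rewrite (_ : (i - 2 - rank A T).+1 = i - 1 - rank A T); last by lia.
  by rewrite !addnA.
Qed.

End Search.

(** * The comparison indices of 2Merge *)

Section Midx.
Variable R : realType.
Local Open Scope ring_scope.

(** Every index computed exactly below has the form of an integer minus [N / 2 ^ k], so its ceiling
    is a natural number division. *)
Lemma absz_ceil_sub_div (x : R) (n a b : nat) : (0 < b)%N -> (a %/ b <= n)%N ->
  x = n%:R - a%:R / b%:R -> absz (Num.ceil x) = (n - a %/ b)%N.
Proof.
move=> b0 abn xE.
suff -> : Num.ceil x = (n - a %/ b)%N%:Z by [].
have bR : 0 < b%:R :> R by rewrite ltr0n.
apply: ceil_def; rewrite rmorphB /= -!pmulrn natrB // xE.
have E : (a %/ b)%:R * b%:R + (a %% b)%:R = a%:R :> R by rewrite -natrM -natrD -divn_eq.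
have r0 : 0 <= (a %% b)%:R :> R by rewrite ler0n.
have r1 : (a %% b)%:R < b%:R :> R by rewrite ltr_nat ltn_mod.
have -> : a%:R / b%:R = (a %/ b)%:R + (a %% b)%:R / b%:R :> R.
  by rewrite -E mulrDl mulfK // gt_eqF.
have q0 : 0 <= (a %% b)%:R / b%:R :> R by rewrite divr_ge0 // ltW.
have q1 : (a %% b)%:R / b%:R < 1 :> R by rewrite ltr_pdivrMr // mul1r.
by apply/andP; split; lra.
Qed.

Variable N : nat.
Hypothesis N1 : (1 < N)%N.
Let K := clg N.
Let p := pp R N.

Lemma pow2_gt0 (k : nat) : 0 < 2 ^+ k :> R.
Proof. by rewrite exprn_gt0. Qed.

Lemma pp_gt : 1 / 2 < p.
Proof.
have [k [Ek /andP[kN _]]] := clg_bounds _ N1.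
rewrite /p /pp Ek; set t := (2 ^ _)%N.
have tN : (t < 2 * N)%N by rewrite /t expnS ltn_pmul2l.
have t0 : 0 < t%:R :> R by rewrite ltr0n expn_gt0.
rewrite ltr_pdivlMr //.
by have : t%:R < 2 * N%:R :> R; [rewrite -natrM ltr_nat | lra].
Qed.

Lemma pp_le1 : p <= 1.
Proof.
have [k [Ek /andP[_ Nk]]] := clg_bounds _ N1.
by rewrite /p /pp Ek ler_pdivrMr ?ltr0n ?expn_gt0 // mul1r ler_nat.
Qed.

Lemma pp_gt34 : (3 / 4 < p) = (3 * 2 ^ K < 4 * N)%N.
Proof.
rewrite /p /pp -/K ltr_pdivlMr ?ltr0n ?expn_gt0 //.
rewrite -(ltr_nat R) !natrM.
by apply/idP/idP => H; lra.
Qed.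

Lemma natr_pow2 : N%:R = p * 2 ^+ K :> R.
Proof. by rewrite /p /pp -/K natrX divfK // gt_eqF // pow2_gt0. Qed.

Lemma midx0 : midx R N 0 = 0%N.
Proof. by rewrite /midx /alpha /= expr0 invr1 subrr mul0r ceil0. Qed.

Lemma midx_even (k : nat) : midx R N k.*2 = (N - N %/ 2 ^ k)%N.
Proof.
apply: absz_ceil_sub_div; rewrite ?expn_gt0 ?leq_div // /alpha odd_double doubleK.
by rewrite natrX mulrBl mul1r mulrC.
Qed.

(** Since [N / p = 2 ^ K], the correction term of [alpha] contributes [2 ^ (K - k.+2)], an integer
    by [k.+2 <= K]. The gap to the preceding even index is therefore exactly this power of 2. *)
Lemma midx_odd_hi (k : nat) : (3 * 2 ^ K < 4 * N)%N -> (k.+2 <= K)%N ->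
  midx R N k.*2.+1 = (N + 2 ^ (K - k.+2) - N %/ 2 ^ k)%N.
Proof.
move=> hi kK; apply: absz_ceil_sub_div; rewrite ?expn_gt0 //.
  by rewrite (leq_trans (leq_div _ _)) // leq_addr.
rewrite /alpha /= odd_double /= doubleK pp_gt34 hi subn1 /=.
rewrite natrD natrX natrX -/p.
have p0 : 0 < p by have := pp_gt; lra.
have E : 2 ^+ K = 2 ^+ (K - k.+2) * 2 ^+ k.+2 :> R by rewrite -exprD subnK.
rewrite !mulrDl mul1r mulNr [_^-1 * _]mulrC natr_pow2 E.
rewrite !exprS; have := pow2_gt0 k; move: (2 ^+ k) (2 ^+ (K - _)) => x y x0.
by field; rewrite !gt_eqF.
Qed.

(** Here the correction is subtracted, and the gap to the following even index is the power of 2. *)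
Lemma midx_odd_lo (k : nat) : (4 * N <= 3 * 2 ^ K)%N -> (k.+3 <= K)%N ->
  midx R N k.*2.+1 = (N - 2 ^ (K - k.+3) - N %/ 2 ^ k.+1)%N.
Proof.
move=> lo kK.
have E : 2 ^+ K = 2 ^+ (K - k.+3) * 2 ^+ k.+3 :> R by rewrite -exprD subnK.
have EN : (2 ^ K = 2 ^ (K - k.+3) * 2 ^ k.+3)%N by rewrite -expnD subnK.
have tN : (2 ^ (K - k.+3) * 4 <= N)%N.
  have [k' [Ek /andP[kN _]]] := clg_bounds _ N1.
  have : (2 ^ K <= 2 * N)%N by rewrite /K Ek expnS leq_mul2l ltnW.
  by rewrite EN !expnS; have : (0 < 2 ^ k)%N; [rewrite expn_gt0 | nia].
have dN : (N %/ 2 ^ k.+1 <= N %/ 2)%N by rewrite leq_div2l // expnS leq_pmulr ?expn_gt0.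
apply: absz_ceil_sub_div; rewrite ?expn_gt0 //; first by lia.
rewrite /alpha /= odd_double /= doubleK pp_gt34 ltnNge lo /=.
rewrite natrB ?natrX; last by lia.
have p0 : 0 < p by have := pp_gt; lra.
rewrite -/p !mulrDl mul1r !mulNr [_^-1 * _]mulrC natr_pow2 E.
rewrite !exprS; have := pow2_gt0 k; move: (2 ^+ k) (2 ^+ (K - _)) => x y x0.
by field; rewrite !gt_eqF.
Qed.

Lemma midx_gt (r m : nat) : m%:R < alpha r p * N%:R -> (m < midx R N r)%N.
Proof.
move=> H; have c : (m%:Z < Num.ceil (alpha r p * N%:R))%R by rewrite ceil_gt_int -pmulrn.
by rewrite /midx -/p -ltz_nat gez0_abs // ltW // (le_lt_trans _ c).
Qed.

Lemma midx_gt0 (r : nat) : (0 < r)%N -> (0 < midx R N r)%N.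
Proof.
move=> r0; apply: midx_gt; rewrite mulr_gt0 //; last by rewrite ltr0n ltnW.
have := pp_gt; rewrite /alpha; move: p => q q0; case: ifP => [ro|re].
  have [k -> ] : exists k, r = k.*2.+1.
    by exists r./2; rewrite -[LHS]odd_double_half ro.
  rewrite -doubleS doubleK subn1 /=.
  have k0 := pow2_gt0 k.
  have k1 : 1 <= 2 ^+ k :> R by rewrite exprn_ege1 // ler1n.
  case: ifP => _.
    have : (2 ^+ k)^-1 <= 1 :> R by rewrite invf_le1.
    have : 0 < 1 / (q * 2 ^+ k.+2) by rewrite divr_gt0 // mulr_gt0 ?pow2_gt0 //; lra.
    by lra.
  have : (2 ^+ k.+1)^-1 <= 1 / 2 :> R.
    by rewrite -[_^-1]div1r lter_pdivrMr ?pow2_gt0 // exprS; lra.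
  have : 1 / (q * 2 ^+ k.+3) <= 1 / 4.
    have q1 : 0 < q by lra.
    rewrite lter_pdivrMr; last exact: mulr_gt0 q1 (pow2_gt0 _).
    have : 0 <= (q - 1 / 2) * 2 ^+ k by apply: mulr_ge0; lra.
    by rewrite !exprS; lra.
  by move: (1 / _) (2 ^- _) => u v; lra.
have [k k0 -> ] : exists2 k, (0 < k)%N & r = k.*2.
  by exists r./2; [lia | rewrite -[LHS]odd_double_half re].
rewrite doubleK; case: k k0 => // k _.
have k1 : 1 <= 2 ^+ k :> R by rewrite exprn_ege1 // ler1n.
have : (2 ^+ k.+1)^-1 <= 1 / 2 :> R.
  by rewrite -[_^-1]div1r lter_pdivrMr ?pow2_gt0 // exprS; lra.
by lra.
Qed.

(** The [2 lg N] rounds suffice: the last index already lies beyond the list, so the search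
    stops. *)
Lemma midx_fuel : (N - 2 < midx R N (trunc_log 2 (N * N)))%N.
Proof.
have /andP[] := @trunc_log_bounds 2 (N * N) isT ltac:(by rewrite muln_gt0; lia).
set F := trunc_log _ _.
have := odd_double_half F; case: (odd F) => /= <-; set k := F./2 => h1 h2.
  (* The fuel is odd, which forces [K = k.+1]. The correction term is then [1 / 2] or [1 / 4], not
     an integer, so the formulas for odd indices do not apply and the estimate is made over the
     reals. *)
  have E2 : (2 ^ k * 2 ^ k = 2 ^ k.*2)%N by rewrite -expnD addnn.
  have N2k : (2 ^ k < N <= 2 ^ k.+1)%N.
    by move: h1 h2; rewrite !expnS -E2; nia.
  have EK : K = k.+1 by exact: clgP.
  apply: midx_gt; rewrite natrB // /alpha /= odd_double /= doubleK subn1 /=.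
  have := pp_le1; have := pp_gt; rewrite -!/p natr_pow2 EK !exprS.
  have := pow2_gt0 k; move: (p) (2 ^+ k) => q x x0 q0 q1.
  have qx : q * x != 0 by rewrite mulf_neq0 // gt_eqF //; lra.
  case: ifP => _.
    have -> : (1 - x^-1 + 1 / (q * (2 * (2 * x)))) * (q * (2 * x)) =
              q * (2 * x) - 2 * q + 1 / 2 by field; rewrite !gt_eqF //; lra.
    by lra.
  have -> : (1 - (2 * x)^-1 - 1 / (q * (2 * (2 * (2 * x))))) * (q * (2 * x)) =
            q * (2 * x) - q - 1 / 4 by field; rewrite !gt_eqF //; lra.
  by lra.
rewrite add0n in h1 h2 *; rewrite midx_even.
have E2 : (2 ^ k * 2 ^ k = 2 ^ k.*2)%N by rewrite -expnD addnn.
have qN : (N < 2 * 2 ^ k)%N by move: h2; rewrite expnS -E2; nia.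
have : (N %/ 2 ^ k < 2)%N by rewrite ltn_divLR ?expn_gt0.
by lia.
Qed.

End Midx.

(** * Averaging over permutations *)

(** The last two entries of the input are inserted last, so permutations are decomposed from the
    right. *)
Lemma perm_permutations_rcons (U : seq nat) : uniq U -> 0 < size U ->
  perm_eq (permutations U)
    [seq rcons s y | y <- U, s <- permutations (rem y U)].
Proof.
move=> uU U0; apply: uniq_perm; first exact: permutations_uniq.
  apply: allpairs_uniq_dep => // [y _|]; first exact: permutations_uniq.
  by move=> [y s] [y' s'] _ _ /= /rcons_inj [-> ->].
move=> t; rewrite mem_permutations; apply/idP/allpairsPdep.
  case/lastP: t => [|s y] st; first by move: U0; rewrite -(perm_size st).
  have yU : y \in U by rewrite -(perm_mem st) mem_rcons inE eqxx.
  exists y, s; split=> //; rewrite mem_permutations -(perm_cons y).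
  by rewrite -(permPr (perm_to_rem yU)) -perm_rcons.
case=> y [s [yU sU ->]]; rewrite mem_permutations in sU.
by rewrite (permPr (perm_to_rem yU)) perm_rcons perm_cons.
Qed.

Lemma sum_permutations_rcons (U : seq nat) (F : seq nat -> nat) :
  uniq U -> 0 < size U ->
  \sum_(s <- permutations U) F s =
  \sum_(y <- U) \sum_(s <- permutations (rem y U)) F (rcons s y).
Proof.
by move=> uU U0; rewrite (perm_big _ (perm_permutations_rcons _ uU U0)) big_allpairs_dep.
Qed.

Lemma rank_nth_sorted (W : seq nat) (j : nat) :
  sorted ltn W -> j < size W -> rank (nth 0 W j) W = j.
Proof. by move=> sW jW; exact: (count_lt_nth 0 (s := W)). Qed.

(** This is the uniformity of ranks: after sorting, the ranks of distinct elements are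
    [0, 1, 2, ...]. *)
Lemma sum_rank (V : seq nat) (f : nat -> nat) : uniq V ->
  \sum_(x <- V) f (rank x V) = \sum_(0 <= j < size V) f j.
Proof.
move=> uV; set W := sort leq V.
have pW : perm_eq W V by rewrite perm_sort.
have sW : sorted ltn W by rewrite ltn_sorted_uniq_leq sort_uniq uV (sort_sorted leq_total).
rewrite -(perm_big _ pW) /= (big_nth 0) (perm_size pW).
apply: eq_big_nat => j /andP[_ jV]; congr f.
by rewrite -(perm_rank _ _ _ pW) rank_nth_sorted // (perm_size pW).
Qed.

Lemma rank_rem (a x : nat) (U : seq nat) : x \in U ->
  rank a U = (x < a) + rank a (rem x U).
Proof. by move=> xU; rewrite (perm_rank _ _ _ (perm_to_rem xU)). Qed.

Lemma ltn_rank (x y : nat) (U : seq nat) : x \in U -> x < y -> rank x U < rank y U.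
Proof.
move=> xU xy; rewrite !(rank_rem _ _ _ xU) ltnn xy add0n add1n ltnS.
exact/leq_rank/ltnW.
Qed.

Lemma rank_inj (U : seq nat) : {in U &, injective (rank^~ U)}.
Proof.
move=> x y xU yU /= E; have [xy|yx|//] := ltngtP x y.
  by have := ltn_rank _ _ _ xU xy; rewrite E ltnn.
by have := ltn_rank _ _ _ yU yx; rewrite E ltnn.
Qed.

Lemma sum_rank_pairs (U : seq nat) (F : nat -> nat -> nat) : uniq U ->
  \sum_(y <- U) \sum_(x <- rem y U) F (rank x U) (rank y U) =
  \sum_(0 <= j < size U) \sum_(0 <= i < size U | i != j) F i j.
Proof.
move=> uU; rewrite -(sum_rank U (fun j => \sum_(0 <= i < size U | i != j) F i j)) //.
apply: eq_big_seq => y yU.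
rewrite rem_filter // big_filter big_mkcond [RHS]big_mkcond /=.
rewrite -(sum_rank U (fun i => if i != rank y U then F i (rank y U) else 0)) //.
by apply: eq_big_seq => x xU; rewrite -(inj_in_eq (@rank_inj U)).
Qed.

(** [(maxn i j).-1] is the rank of the larger element when the smaller one is left out of the count.
    The two orders of a pair give the factor 2, and [h] counts the old elements between the two. *)
Lemma sum_triangle (N : nat) (F : nat -> nat -> nat) :
  \sum_(0 <= j < N) \sum_(0 <= i < N | i != j) F (minn i j) (maxn i j).-1 =
  2 * \sum_(0 <= g < N.-1) \sum_(0 <= h < N - 1 - g) F g (g + h).
Proof.
pose lower := \sum_(0 <= j < N) \sum_(0 <= i < N | i < j) F i j.-1.
transitivity (2 * lower).
  rewrite mul2n -addnn {2}/lower.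
  under [X in _ = _ + X]eq_bigr => j _ do rewrite big_mkcond.
  rewrite exchange_big -big_split; apply: eq_bigr => j _ /=.
  rewrite -big_mkcond (bigID (fun i => i < j)) /=; congr addn.
    rewrite (eq_bigl (fun i => i < j)); last by move=> i; case: ltngtP.
    by apply: eq_bigr => i ij; rewrite (minn_idPl (ltnW ij)) (maxn_idPr (ltnW ij)).
  rewrite (eq_bigl (fun i => j < i)); last by move=> i; case: ltngtP.
  by apply: eq_bigr => i ij; rewrite (minn_idPr (ltnW ij)) (maxn_idPl (ltnW ij)).
congr (2 * _); rewrite /lower {lower}.
under eq_bigr => j _ do rewrite big_mkcond.
rewrite exchange_big /=.
case: N => [|N]; first by rewrite !big_nil.
rewrite big_nat_recr //= [X in _ + X]big1_seq ?addn0; last first.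
  by move=> j /andP[_]; rewrite mem_index_iota ltnS => /andP[_ jN]; rewrite ltnNge jN.
apply: eq_big_nat => g /andP[_ gN].
rewrite (big_cat_nat (n := g.+1)) //=; last by lia.
rewrite big1_seq ?add0n; last first.
  by move=> j /andP[_]; rewrite mem_index_iota ltnS => /andP[_ jN]; rewrite ltnNge jN.
rewrite -{1}[g.+1]add0n big_addn subSS subn1 /=.
apply: eq_big_nat => h /andP[_ hN].
by rewrite addnS /= ltnS leq_addl addnC.
Qed.

(** * Recursion for the total cost over all permutations *)

Section Complexity.
Variable R : realType.

Definition ins_step (N x y : nat) (T : seq nat) : seq nat * nat :=
  if use_merge R N then merge2 R x y T else
  let: (l1, c1) := rhbs x T in
  let T1 := ins_at x l1 T in
  let: (l2, c2) := rhbs y T1 in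
  (ins_at y l2 T1, c1 + c2).

Lemma ins12S (m : nat) (S : seq nat) :
  let N := 2 * m.+2 in
  let r := ins_step N (nth 0 S (N - 2)) (nth 0 S (N - 1)) (ins12 R m.+1 S).1 in
  ins12 R m.+2 S = (r.1, (ins12 R m.+1 S).2 + r.2).
Proof.
rewrite /ins_step -[ins12 R m.+2 S]/(let: (T', c) := ins12 R m.+1 S in _).
case: (ins12 R m.+1 S) => T c /=.
case: ifP => _; first by case: (merge2 _ _ _ _).
by case: (rhbs _ _) => l1 c1; case: (rhbs _ _) => l2 c2; rewrite addnA.
Qed.

Lemma eq_ins12 (m : nat) (S S' : seq nat) :
  (forall k, k < 2 * m -> nth 0 S k = nth 0 S' k) -> ins12 R m S = ins12 R m S'.
Proof.
elim: m => [|[|m] IH] // H; first by rewrite /= !H.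
rewrite !ins12S IH ?H //; try lia.
by move=> k km; apply: H; lia.
Qed.

(* The cost of inserting a pair, in terms of the ranks [i] of the first and [j]
   of the second element among all [N]. *)
Definition merge_cost (N i j : nat) : nat :=
  1 + cost_small R N (minn i j) + dep (N - 1 - minn i j) ((maxn i j).-1 - minn i j).

Lemma ins_stepP (x y : nat) (T : seq nat) : 1 < size T -> sorted ltn T ->
  x \notin T -> y \notin T -> x != y ->
  let N := (size T).+2 in
  [/\ sorted ltn (ins_step N x y T).1, perm_eq (ins_step N x y T).1 [:: x, y & T] &
    (ins_step N x y T).2 =
      if use_merge R N then merge_cost N (rank x [:: x, y & T]) (rank y [:: x, y & T])
      else dep N.-1 (rank x (x :: T)) + dep N (rank y [:: x, y & T])].
Proof.
move=> T1 sT xT yT xy N; rewrite /ins_step.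
have N1 : 1 < N by [].
have NT : size T = N - 2 by rewrite /N subn2.
case: ifP => _.
  have F0 : 0 < trunc_log 2 (N * N) by rewrite trunc_log_gt0 /= /N; lia.
  have [h1 h2 h3] := @merge2E R N x y T N1 sT xT yT xy NT (@midx_gt0 R N N1)
    (midx0 R N) (midx_fuel R N N1) F0.
  split=> //; rewrite h3 /merge_cost !rank_cons !ltnn.
  have -> : minn (0 + ((y < x) + rank x T)) ((x < y) + (0 + rank y T)) =
            minn (rank x T) (rank y T).
    have [lt|gt|eq] := ltngtP x y; last by rewrite eq eqxx in xy.
      by have := leq_rank _ _ T (ltnW lt); lia.
    by have := leq_rank _ _ T (ltnW gt); lia.
  have -> // : (maxn (0 + ((y < x) + rank x T)) ((x < y) + (0 + rank y T))).-1 =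
            maxn (rank x T) (rank y T).
  have [lt|gt|eq] := ltngtP x y; last by rewrite eq eqxx in xy.
    by have := leq_rank _ _ T (ltnW lt); lia.
  by have := leq_rank _ _ T (ltnW gt); lia.
rewrite rhbsE //.
have pT1 := perm_ins_at x (rank x T) T.
have sT1 := sorted_ins_at x T sT xT.
have yT1 : y \notin ins_at x (rank x T) T.
  by rewrite (perm_mem pT1) inE negb_or eq_sym xy.
rewrite rhbsE // (perm_size pT1) /=.
split; first exact: sorted_ins_at.
  apply: perm_trans (perm_ins_at _ _ _) _; apply: (@perm_trans _ [:: y, x & T]).
    by rewrite perm_cons.
  by rewrite (perm_catCA [:: y] [:: x]).
by rewrite (perm_rank _ _ _ pT1) !rank_cons !ltnn.
Qed.

Lemma ins12P (m : nat) (S : seq nat) : uniq S -> 2 * m.+1 <= size S ->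
  sorted ltn (ins12 R m.+1 S).1 /\ perm_eq (ins12 R m.+1 S).1 (take (2 * m.+1) S).
Proof.
move=> uS; elim: m => [|m IH] mS.
  case: S uS mS => [|x [|y S]] //=; rewrite inE negb_or => /andP[/andP[xy _] _] _.
  rewrite take0 /=; case: ltngtP xy => // h _; split=> //=; rewrite ?h //.
  by rewrite (perm_catCA [:: y] [:: x] [::]).
have {IH} [|sT pT] := IH; first by lia.
rewrite ins12S /=; set T := (ins12 R m.+1 S).1 in sT pT *.
set N := 2 * m.+2; set x := nth 0 S (N - 2); set y := nth 0 S (N - 1).
have NE : N = 2 * m.+2 by [].
have Nm : 2 * m.+1 = N - 2 by lia.
clearbody N.
have szT : size T = N - 2 by rewrite (perm_size pT) size_takel //
  (leq_trans _ mS) // leq_mul2l /= leqnSn.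
have N4 : 3 < N by lia.
have E : take N S = rcons (rcons (take (N - 2) S) x) y.
  have e1 : N = (N - 2).+2 by lia.
  have e2 : N - 1 = (N - 2).+1 by lia.
  by rewrite /y e2 [in LHS]e1 (take_nth 0) ?(take_nth 0) //; lia.
have uE : uniq (take N S) by exact: take_uniq.
rewrite E !rcons_uniq mem_rcons inE negb_or in uE.
case/and3P: uE => /andP[yx yT] xT uT.
have T1 : 1 < size T by rewrite szT; lia.
rewrite -Nm -(perm_mem pT) in xT; rewrite -Nm -(perm_mem pT) in yT.
rewrite eq_sym in yx.
have [h1 h2 _] := ins_stepP x y T T1 sT xT yT yx.
have NT : (size T).+2 = N by rewrite szT; lia.
rewrite -{1 2}NT; split=> //; apply: perm_trans h2 _.
rewrite E perm_sym perm_rcons; apply: (@perm_trans _ [:: y, x & take (N - 2) S]).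
  by rewrite perm_cons perm_rcons.
by rewrite (perm_catCA [:: y] [:: x]) /= !perm_cons perm_sym -Nm.
Qed.

(** Cost of one step summed over the [N * (N - 1)] equally likely pairs of ranks. When merging, the
    larger element runs over all [N - 1 - g] leaves of its search tree, hence the path length. *)
Definition step_sum (N : nat) : nat :=
  if use_merge R N then
    2 * \sum_(0 <= g < N.-1)
      ((N - 1 - g) * (1 + cost_small R N g) + path_len (N - 1 - g))
  else N * path_len N.-1 + N.-1 * path_len N.

Lemma sum_ins_step (U : seq nat) (T : nat -> nat -> seq nat) :
  uniq U -> 3 < size U ->
  (forall x y, y \in U -> x \in rem y U ->
     sorted ltn (T x y) /\ perm_eq (T x y) (rem x (rem y U))) ->
  \sum_(y <- U) \sum_(x <- rem y U) (ins_step (size U) x y (T x y)).2 =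
  step_sum (size U).
Proof.
move=> uU U4 HT; set N := size U.
have key x y : y \in U -> x \in rem y U -> (ins_step N x y (T x y)).2 =
  if use_merge R N then merge_cost N (rank x U) (rank y U)
      else dep N.-1 (rank x (rem y U)) + dep N (rank y U).
  move=> yU xU; have [sT pT] := HT x y yU xU.
  have uyU : uniq (rem y U) by exact: rem_uniq.
  have pV : perm_eq (x :: T x y) (rem y U).
    by rewrite perm_sym (permPl (perm_to_rem xU)) perm_cons perm_sym.
  have pU : perm_eq [:: x, y & T x y] U.
    rewrite (perm_catCA [:: x] [:: y]) perm_sym (permPl (perm_to_rem yU)) perm_cons.
    by rewrite perm_sym.
  have uU' : uniq [:: x, y & T x y] by rewrite (perm_uniq pU).
  have szU : (size (T x y)).+2 = N by rewrite /N -(perm_size pU).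
  move: uU'; rewrite /= inE negb_or => /and3P[/andP[xy xT] yT _].
  have T1 : 1 < size (T x y) by lia.
  have [_ _] := ins_stepP x y (T x y) T1 sT xT yT xy.
  by rewrite szU => ->; rewrite !(perm_rank _ _ _ pU) (perm_rank _ _ _ pV).
transitivity (\sum_(y <- U) \sum_(x <- rem y U)
  if use_merge R N then merge_cost N (rank x U) (rank y U)
      else dep N.-1 (rank x (rem y U)) + dep N (rank y U)).
  by apply: eq_big_seq => y yU; apply: eq_big_seq => x xU; exact: key.
rewrite /step_sum; case: ifP => _.
  rewrite (sum_rank_pairs U (merge_cost N)) //.
  rewrite (sum_triangle N (fun g h => 1 + cost_small R N g + dep (N - 1 - g) (h - g))).
  congr (2 * _); apply: eq_big_nat => g /andP[_ gN].
  rewrite big_split /= sum_nat_const_nat subn0; congr (_ + _).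
  rewrite -sum_dep; last by lia.
  by apply: eq_bigr => h _; rewrite addKn.
have N1 : 0 < (size U).-1 by case: (size U) U4 => [|[|]].
have N0 : 0 < size U by case: (size U) U4.
under eq_big_seq => y yU.
  rewrite big_split /= (sum_rank (rem y U) (dep N.-1)) ?rem_uniq // size_rem //.
  rewrite sum_dep // big_const_seq count_predT size_rem // iter_addn_0.
  over.
rewrite big_split /= big_const_seq count_predT iter_addn_0 mulnC; congr (_ + _).
by rewrite -big_distrl /= (sum_rank U (dep N)) // sum_dep // mulnC.
Qed.

(** The index [m] stands for [2 m + 2] elements. The product counts the choices of the last two
    entries, and the factorial the orders of the entries before them. *)
Fixpoint total_cost (m : nat) : nat :=
  if m is m'.+1 then
    (2 * m).+2 * (2 * m).+1 * total_cost m' + (2 * m)`! * step_sum (2 * m).+2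
  else 2.

Lemma sum_ins12 (m : nat) (U : seq nat) : uniq U -> size U = (2 * m).+2 ->
  \sum_(s <- permutations U) (ins12 R m.+1 s).2 = total_cost m.
Proof.
elim: m U => [|m IH] U uU Um.
  rewrite (eq_bigr (fun=> 1)) // big_const_seq count_predT size_permutations //.
  by rewrite Um iter_addn_0.
have Um' : size U = 2 * m.+2 by lia.
(* The recursive call sorts, so its result does not depend on the order of the remaining elements;
   [T x y] is this common result. *)
pose T x y := (ins12 R m.+1 (rem x (rem y U))).1.
have uV y : uniq (rem y U) by exact: rem_uniq.
have uW x y : uniq (rem x (rem y U)) by exact: rem_uniq.
have Vm y : y \in U -> size (rem y U) = (2 * m.+1).+1 by move=> yU; rewrite size_rem // Um.
have Wm x y : y \in U -> x \in rem y U -> size (rem x (rem y U)) = 2 * m.+1.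
  by move=> yU xV; rewrite size_rem // Vm.
have TP x y : y \in U -> x \in rem y U ->
    sorted ltn (T x y) /\ perm_eq (T x y) (rem x (rem y U)).
  move=> yU xV; have [|h1 h2] := ins12P m _ (uW x y); first by rewrite Wm.
  by split=> //; rewrite take_oversize ?Wm // in h2.
rewrite sum_permutations_rcons // ?Um //.
transitivity (\sum_(y <- U) \sum_(x <- rem y U)
    (total_cost m + (2 * m.+1)`! * (ins_step (size U) x y (T x y)).2)).
  apply: eq_big_seq => y yU.
  rewrite sum_permutations_rcons ?Vm //; apply: eq_big_seq => x xV.
  have Wm' : size (rem x (rem y U)) = (2 * m).+2 by rewrite Wm //; lia.
  rewrite -(IH _ (uW x y) Wm') -(Wm x y yU xV) -size_permutations //.
  rewrite mulnC -iter_addn_0 -count_predT -big_const_seq -big_split.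
  apply: eq_big_seq => s; rewrite mem_permutations => sW.
  have sm : size s = 2 * m.+1 by rewrite (perm_size sW) Wm.
  have us : uniq s by rewrite (perm_uniq sW).
  have Es : ins12 R m.+1 (rcons (rcons s x) y) = ins12 R m.+1 s.
    by apply: eq_ins12 => k km; rewrite !nth_rcons size_rcons sm km ltnS ltnW.
  have e1 : 2 * m.+2 - 2 = size s by rewrite sm; lia.
  have e2 : 2 * m.+2 - 1 = size (rcons s x) by rewrite size_rcons sm; lia.
  rewrite ins12S Es /= e1 e2 -Um'; congr (_ + (ins_step _ _ _ _).2).
  - by rewrite nth_rcons size_rcons ltnSn nth_rcons ltnn eqxx.
  - by rewrite nth_rcons ltnn eqxx.
  - have [sT pT] := TP x y yU xV; have [|h1 h2] := ins12P m _ us; first by rewrite sm.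
    rewrite take_oversize ?sm // in h2.
    apply: (irr_sorted_eq ltn_trans ltnn h1 sT) => z.
    by rewrite (perm_mem h2) (perm_mem sW) (perm_mem pT).
rewrite (eq_big_seq (fun y => (2 * m.+1).+1 * total_cost m + (2 * m.+1)`! *
   \sum_(x <- rem y U) (ins_step (size U) x y (T x y)).2)); last first.
  move=> y yU; rewrite big_split /= -big_distrr /=; congr (_ + _).
  by rewrite big_const_seq count_predT iter_addn_0 Vm // mulnC.
rewrite big_split -[total_cost m.+1]/((2 * m.+1).+2 * (2 * m.+1).+1 * total_cost m +
  (2 * m.+1)`! * step_sum (2 * m.+1).+2) -Um; congr (_ + _).
  by rewrite big_const_seq count_predT iter_addn_0 mulnC mulnA.
by rewrite -big_distrr sum_ins_step // Um; lia.
Qed.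

End Complexity.

(** * The cost of the smaller element *)

(** [2 ^ k] may exceed the least power of 2 above [L]; then all leaves have depth below [k], which
    leaves room for the boolean. *)
Lemma dep_le (L k j : nat) : 0 < L <= 2 ^ k -> j < L -> dep L j + (j < 2 ^ k - L) <= k.
Proof.
case/andP => L0 Lk jL; rewrite /dep.
have : clg L <= k by apply: up_log_min.
rewrite leq_eqVlt => /predU1P[->|lt].
  case: ltnP => // lt; rewrite subnK //.
  by case: k Lk lt => // Lk; rewrite expn0; lia.
have := leq_b1 (j < 2 ^ k - L); lia.
Qed.

Lemma dep_clg (L j : nat) : dep L j <= clg L.
Proof. exact: leq_subr. Qed.

(** The [chunk] lemmas isolate the integer arithmetic of round [k]: [x] and [y] stand for
    [N %/ 2 ^ k.-1] and [N %/ 2 ^ k], [t] for the power of 2 in the odd index, and [N - 1 - v] for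
    the rank of the smaller element. In the gap that need not be a power of 2, a [v] beyond the
    break lands in a shallow leaf. *)
Lemma chunk_hi_even (N x y v t : nat) :
  N - 1 - v < N - y -> N + t - x <= N - 1 - v -> v < N -> 1 < y ->
  y.*2 <= x <= y.*2.+1 -> 3 * t <= x <= 4 * t -> 0 < t -> x <= N ->
  let lo := N + t - x in let L := (minn (N - y).-1 (N - 2) - lo).+1 in
  [/\ y <= v < x, 0 < L <= t, N - 1 - v - lo < L &
    (v < 2 * x - y - 3 * t) || (N - 1 - v - lo < t - L)].
Proof. by move=> *; split; lia. Qed.

Lemma chunk_hi_odd (N x y v t : nat) :
  N - 1 - v < N + t - x -> N - x <= N - 1 - v -> v < N ->
  y.*2 <= x <= y.*2.+1 -> 3 * t <= x -> 0 < t -> x <= N ->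
  y <= v < x /\ (minn (N + t - x).-1 (N - 2) - (N - x)).+1 = t.
Proof. by move=> *; split; lia. Qed.

Lemma chunk_lo_even (N x y v t : nat) :
  N - 1 - v < N - y -> N - t - y <= N - 1 - v -> v < N -> 1 < y ->
  y.*2 <= x <= y.*2.+1 -> 4 * t <= x <= 6 * t -> 0 < t -> x <= N ->
  [/\ y <= v < x, (minn (N - y).-1 (N - 2) - (N - t - y)).+1 = t &
    v < 2 * x - y - 3 * t].
Proof. by move=> *; split; lia. Qed.

Lemma chunk_lo_odd (N x y v t : nat) :
  N - 1 - v < N - t - y -> N - x <= N - 1 - v -> v < N ->
  y.*2 <= x <= y.*2.+1 -> 4 * t <= x <= 6 * t -> 0 < t -> x <= N ->
  let lo := N - x in let L := (minn (N - t - y).-1 (N - 2) - lo).+1 in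
  [/\ y <= v < x, 0 < L <= 2 * t, N - 1 - v - lo < L &
    (v < 2 * x - y - 3 * t) || (N - 1 - v - lo < 2 * t - L)].
Proof. by move=> *; split; lia. Qed.

Section SmallCost.
Variables (R : realType) (N : nat).
Hypothesis N4 : 4 <= N.
Let K := clg N.

Lemma gsearch_cost_small (v : nat) : 0 < v < N ->
  exists r c, let lo := midx R N r.-1 in let hi := minn (midx R N r).-1 (N - 2) in
  [/\ cost_small R N (N - 1 - v) = c + dep (hi - lo).+1 (N - 1 - v - lo),
      0 < r <= trunc_log 2 (N * N), c <= r, N - 1 - v < midx R N r &
      forall q, 0 < q < r -> midx R N q <= N - 1 - v].
Proof.
move=> vN; have N1 : 1 < N by lia.
have := midx_fuel R N N1.
have : 0 < trunc_log 2 (N * N) by rewrite trunc_log_gt0; nia.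
rewrite /cost_small; set F := trunc_log _ _ => F0 mF.
have [|] := gsearchP R F N (N - 1 - v) 1.
  by exists F.-1; [lia | rewrite add1n prednK //; lia].
case: (gsearch _ _ _ _ _) => r c /= h1 h2 h3 h4.
by exists r, c; split=> //; lia.
Qed.

Lemma clg_half : 2 ^ K < 2 * N /\ N <= 2 ^ K /\ 1 < K.
Proof.
have [k [E /andP[kN Nk]]] : exists k, clg N = k.+1 /\ 2 ^ k < N <= 2 ^ k.+1.
  by apply: clg_bounds; lia.
rewrite /K E; split; first by rewrite expnS; lia.
by split=> //; case: k Nk {E kN} => //; rewrite expn1; lia.
Qed.

(** Applied to [v < 4], where the number of rounds is not controlled by the exact indices; the total
    contribution of these [v] is [O(lg N)]. *)
Lemma cost_small_crude (v : nat) : 0 < v < N -> cost_small R N (N - 1 - v) <= 3 * K.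
Proof.
move=> vN; have [r [c [-> rF cr _ _]]] := gsearch_cost_small v vN.
have [h1 [h2 h3]] := clg_half.
have FK : trunc_log 2 (N * N) <= 2 * K.
  rewrite -(leq_exp2l (m := 2)) //; apply: leq_trans (_ : N * N <= _).
    by apply: trunc_logP => //; rewrite muln_gt0; lia.
  by rewrite mul2n -addnn expnD leq_mul.
set L := (_ - _).+1; have : dep L (N - 1 - v - midx R N r.-1) <= K.
  by apply: leq_trans (dep_clg _ _) _; apply: leq_up_log; rewrite /L; lia.
lia.
Qed.

(** Stopping at the odd comparison [2k - 1] leaves a gap whose search takes exactly [K - k - 1]
    comparisons, in total at most [K + k - 2]. Stopping at [2k] costs one more, unless a shallow
    leaf gives it back. *)
Lemma cost_small_hi (v : nat) : 3 * 2 ^ K < 4 * N -> 4 <= v < N ->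
  exists2 k, 0 < k /\ k.+2 <= K &
    N %/ 2 ^ k <= v < N %/ 2 ^ k.-1 /\
    cost_small R N (N - 1 - v) + 2 <=
      K + k + (v < 2 * (N %/ 2 ^ k.-1) - N %/ 2 ^ k - 3 * 2 ^ (K - k.+1)).
Proof.
move=> hi v4; have N1 : 1 < N by lia.
have [h1 [h2 h3]] := clg_half.
have vN : 0 < v < N by lia.
have [r [c [-> rF cr gr rmin]]] := gsearch_cost_small v vN.
have K2 : 2 < K.
  by rewrite ltnNge; apply/negP => K2; have := leq_pexp2l (isT : 0 < 2) K2; lia.
have EK : 2 ^ K = 2 ^ (K - 2) * 4 by rewrite -(expnD 2 _ 2) subnK // ltnW.
(* The index of round [2 (K - 2)] is at least [N - 4], beyond every [N - 1 - v] with [4 <= v]. Hence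
   [k.+2 <= K], and the exponents below are not truncated. *)
have rK : r <= (K - 2).*2.
  rewrite leqNgt; apply/negP => rK; have := rmin (K - 2).*2; rewrite midx_even.
  have : N %/ 2 ^ (K - 2) <= 4 by have ? : 0 < 2 ^ (K - 2) by [rewrite expn_gt0]; rewrite -ltnS ltn_divLR //; lia.
  by move=> ? H; have := H ltac:(lia); lia.
pose k := uphalf r.
have kr : r = k.*2 \/ r = k.-1.*2.+1 by rewrite /k; lia.
have k0 : 0 < k by rewrite /k; lia.
have kK : k.+2 <= K by rewrite /k; lia.
have [k' kE] : exists k', k = k'.+1 by exists k.-1; lia.
clearbody k; subst k.
exists k'.+1 => //=; rewrite [k'.+1.-1]/= in kr *.
have Ek : 2 ^ K = 4 * (2 ^ (K - k'.+2) * 2 ^ k').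
  by rewrite -[4]/(2 ^ 2) -!expnD; congr (2 ^ _); lia.
have p0 : 0 < 2 ^ (K - k'.+2) by rewrite expn_gt0.
have p2 : 2 ^ (K - k'.+2) = 2 * 2 ^ (K - k'.+3).
  by rewrite -expnS; congr (2 ^ _); lia.
have pk0 : 0 < 2 ^ k' by rewrite expn_gt0.
have yE : N %/ 2 ^ k'.+1 = (N %/ 2 ^ k') %/ 2 by rewrite -divnMA expnSr.
set x := N %/ 2 ^ k' in yE *; set t := 2 ^ (K - k'.+2) in Ek p0 p2 *.
set y := N %/ 2 ^ k'.+1 in yE *.
have x3 : 3 * t <= x.
  by rewrite leq_divRL // -mulnA; move: Ek h1 hi; clear; lia.
have x4 : x <= 4 * t.
  by rewrite -ltnS ltn_divLR // mulSn -mulnA; move: Ek h2 hi pk0; clear; lia.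
have xN : x <= N by exact: leq_div.
have mo : midx R N k'.*2.+1 = N + t - x := midx_odd_hi R N N1 k' hi (ltnW kK).
have me : midx R N k'.+1.*2 = N - y := midx_even R N k'.+1.
have me0 : midx R N k'.*2 = N - x := midx_even R N k'.
have yx : y.*2 <= x <= y.*2.+1 by rewrite yE; move: (x); clear; lia.
have y1 : 1 < y by move: p2 x3 yx p0; clear; lia.
have kEK : K - k'.+2 + k'.+2 = K by rewrite subnK // ltnW.
have vN' : v < N by case/andP: vN.
clearbody x y.
case: kr => rE; subst r; rewrite ?doubleS /= -?doubleS.
  have lo_g : midx R N k'.*2.+1 <= N - 1 - v by apply: rmin; rewrite doubleS /=.
  rewrite mo in lo_g *; rewrite me in gr *.
  have x34 : 3 * t <= x <= 4 * t by rewrite x3.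
  have [h4 h5 h6 h7] := chunk_hi_even N x y v t gr lo_g vN' y1 yx x34 p0 xN.
  split=> //; have := dep_le _ (K - k'.+2) _ h5 h6;
  move: h7 cr kEK; move: (dep _ _) (_ < _ - _.+1) => d b; clear.
  by case: b; case: (v < _) => //= _; lia.
have lo_g : midx R N k'.*2 <= N - 1 - v.
  have [->|k'0] := posnP k'; first by rewrite midx0.
  by apply: rmin; rewrite double_gt0 k'0 ltnSn.
rewrite mo in gr *; rewrite me0 in lo_g *.
have [h4 h5] := chunk_hi_odd N x y v t gr lo_g vN' yx x3 p0 xN.
rewrite h5 dep_pow2; split=> //.
by move: cr kEK; clear; lia.
Qed.

(** The roles of the two gaps are exchanged: the even one has the exact power of 2 and lies wholly
    below the break, while the odd one has the shallow leaves. *)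
Lemma cost_small_lo (v : nat) : 4 * N <= 3 * 2 ^ K -> 4 <= v < N ->
  exists2 k, 0 < k /\ k.+2 <= K &
    N %/ 2 ^ k <= v < N %/ 2 ^ k.-1 /\
    cost_small R N (N - 1 - v) + 3 <=
      K + k + (v < 2 * (N %/ 2 ^ k.-1) - N %/ 2 ^ k - 3 * 2 ^ (K - k.+2)).
Proof.
move=> lo v4; have N1 : 1 < N by lia.
have [h1 [h2 h3]] := clg_half.
have vN : 0 < v < N by lia.
have [r [c [-> rF cr gr rmin]]] := gsearch_cost_small v vN.
have K2 : 2 < K.
  by rewrite ltnNge; apply/negP => K2; have := leq_pexp2l (isT : 0 < 2) K2; lia.
have EK : 2 ^ K = 2 ^ (K - 2) * 4 by rewrite -(expnD 2 _ 2) subnK // ltnW.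
have rK : r <= (K - 2).*2.
  rewrite leqNgt; apply/negP => rK; have := rmin (K - 2).*2; rewrite midx_even.
  have : N %/ 2 ^ (K - 2) <= 4.
    by have ? : 0 < 2 ^ (K - 2) by [rewrite expn_gt0]; rewrite -ltnS ltn_divLR //; lia.
  by move=> ? H; have := H ltac:(lia); lia.
pose k := uphalf r.
have kr : r = k.*2 \/ r = k.-1.*2.+1 by rewrite /k; lia.
have k0 : 0 < k by rewrite /k; lia.
have kK : k.+2 <= K by rewrite /k; lia.
have [k' kE] : exists k', k = k'.+1 by exists k.-1; lia.
clearbody k; subst k.
exists k'.+1 => //=; rewrite [k'.+1.-1]/= in kr *.
have Ek : 2 ^ K = 8 * (2 ^ (K - k'.+3) * 2 ^ k').
  by rewrite -[8]/(2 ^ 3) -!expnD; congr (2 ^ _); lia.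
have p0 : 0 < 2 ^ (K - k'.+3) by rewrite expn_gt0.
have p2 : 2 ^ (K - k'.+2) = 2 * 2 ^ (K - k'.+3).
  by rewrite -expnS; congr (2 ^ _); lia.
have pk0 : 0 < 2 ^ k' by rewrite expn_gt0.
have yE : N %/ 2 ^ k'.+1 = (N %/ 2 ^ k') %/ 2 by rewrite -divnMA expnSr.
set x := N %/ 2 ^ k' in yE *; set t := 2 ^ (K - k'.+3) in Ek p0 p2 *.
set y := N %/ 2 ^ k'.+1 in yE *.
have x3 : 4 * t <= x.
  by rewrite leq_divRL // -mulnA; move: Ek h1 lo; clear; lia.
have x4 : x <= 6 * t.
  by rewrite -ltnS ltn_divLR // mulSn -mulnA; move: Ek h2 lo pk0; clear; lia.
have xN : x <= N by exact: leq_div.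
have mo : midx R N k'.*2.+1 = N - t - y := midx_odd_lo R N N1 k' lo kK.
have me : midx R N k'.+1.*2 = N - y := midx_even R N k'.+1.
have me0 : midx R N k'.*2 = N - x := midx_even R N k'.
have yx : y.*2 <= x <= y.*2.+1 by rewrite yE; move: (x); clear; lia.
have y1 : 1 < y by move: x3 yx p0; clear; lia.
have kEK : K - k'.+3 + k'.+3 = K by rewrite subnK.
have kEK2 : K - k'.+2 + k'.+2 = K by rewrite subnK // ltnW.
have vN' : v < N by case/andP: vN.
have x34 : 4 * t <= x <= 6 * t by rewrite x3.
clearbody x y.
case: kr => rE; subst r; rewrite ?doubleS /= -?doubleS.
  have lo_g : midx R N k'.*2.+1 <= N - 1 - v by apply: rmin; rewrite doubleS /=.
  rewrite mo in lo_g *; rewrite me in gr *.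
  have [h4 h5 h6] := chunk_lo_even N x y v t gr lo_g vN' y1 yx x34 p0 xN.
  rewrite h5 dep_pow2 h6; split=> //.
  by move: cr kEK; clear; lia.
have lo_g : midx R N k'.*2 <= N - 1 - v.
  have [->|k'0] := posnP k'; first by rewrite midx0.
  by apply: rmin; rewrite double_gt0 k'0 ltnSn.
rewrite mo in gr *; rewrite me0 in lo_g *.
have [h4 h5 h6 h7] := chunk_lo_odd N x y v t gr lo_g vN' yx x34 p0 xN.
split=> //; rewrite -p2 in h5 h7; have := dep_le _ (K - k'.+2) _ h5 h6.
move: h7 cr kEK2; move: (dep _ _) (_ < _ - _.+1) => d b; clear.
by case: b; case: (v < _) => //= _; lia.
Qed.

(* The two values correspond to the two branches of [alpha]. In round [k] the
   smaller element costs [K + k - merge_base] comparisons, plus one when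
   [v < break k], where [v] is the number of positions left for the larger one. *)
Definition merge_base : nat := if 3 * 2 ^ K < 4 * N then 2 else 3.

Definition break (k : nat) : nat :=
  2 * (N %/ 2 ^ k.-1) - N %/ 2 ^ k - 3 * 2 ^ (K - (k + merge_base - 1)).

(** The round number [k] is at most the number of levels [j] with [v < N %/ 2 ^ j]. This turns the
    bound into a sum of indicators that can be summed over [v]. *)
Lemma cost_small_le (v : nat) : 4 <= v < N ->
  cost_small R N (N - 1 - v) + merge_base <=
  K + \sum_(0 <= j < K) (v < N %/ 2 ^ j) +
  \sum_(1 <= k < K) (N %/ 2 ^ k <= v < break k).
Proof.
move=> v4.
have [k [k0 kK] [/andP[yv vx] H]] : exists2 k, 0 < k /\ k.+2 <= K &
    N %/ 2 ^ k <= v < N %/ 2 ^ k.-1 /\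
    cost_small R N (N - 1 - v) + merge_base <= K + k + (v < break k).
  rewrite /break /merge_base; case: ltnP => h.
    have [k hk H] := cost_small_hi v h v4; exists k => //.
    have e : k + 2 - 1 = k.+1 by rewrite addn2 subn1.
    by rewrite e.
  have [k hk H] := cost_small_lo v h v4; exists k => //.
  have e : k + 3 - 1 = k.+2 by rewrite addn3 subn1.
  by rewrite e.
apply: leq_trans H _; rewrite -!addnA leq_add2l leq_add //.
  rewrite (big_cat_nat (n := k)) //=; last by lia.
  apply: leq_trans (leq_addr _ _).
  rewrite (eq_big_nat _ _ (F2 := fun=> 1)); first by rewrite sum_nat_const_nat subn0 muln1.
  move=> j /andP[_ jk]; rewrite (leq_trans vx) // leq_div2l ?expn_gt0 //.
  by rewrite leq_exp2l //; lia.
rewrite (bigD1_seq k) ?iota_uniq ?mem_index_iota /=; [|lia|by []].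
by rewrite yv leq_addr.
Qed.

(** The weight [N - 1 - g] is [v], the number of positions left for the larger element. The error is
    [(1 + 2 + 3) * 3 * K.+1], from [v < 4]. *)
Lemma sum_cost_small :
  \sum_(0 <= g < N.-1) (N - 1 - g) * cost_small R N g +
    merge_base * \sum_(0 <= v < N) v <=
  K * \sum_(0 <= v < N) v +
  \sum_(0 <= j < K) \sum_(0 <= v < N %/ 2 ^ j) v +
  \sum_(1 <= k < K) \sum_(N %/ 2 ^ k <= v < break k) v + 18 * K.+1.
Proof.
have -> : \sum_(0 <= g < N.-1) (N - 1 - g) * cost_small R N g =
          \sum_(0 <= v < N) v * cost_small R N (N - 1 - v).
  rewrite big_nat_rev /= add0n [RHS]big_ltn ?mul0n ?add0n; last by lia.
  rewrite [RHS]big_add1; apply: eq_big_nat => g gN.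
  by congr (_ * cost_small R N _); lia.
rewrite !big_distrr /= -big_split /=.
have sub n : n <= N -> \sum_(0 <= v < n) v = \sum_(0 <= v < N) v * (v < n).
  move=> nN; rewrite (big_nat_widen _ _ N) // big_mkcond /=.
  by apply: eq_bigr => v _; case: (v < n); rewrite ?muln1 ?muln0.
have sub2 n m : \sum_(0 <= v < N) v * (n <= v < m) <= \sum_(n <= v < m) v.
  have -> : \sum_(n <= v < m) v = \sum_(0 <= v < m + N) v * (n <= v < m).
    rewrite (big_nat_widenl n 0) // (big_nat_widen _ _ (m + N)) ?leq_addr //=.
    rewrite big_mkcond; apply: eq_bigr => v _.
    by case: (n <= v < m); rewrite ?muln1 ?muln0.
  by rewrite [X in _ <= X](big_cat_nat (n := N)) ?leq_addl //= leq_addr.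
have E1 : \sum_(0 <= j < K) \sum_(0 <= v < N %/ 2 ^ j) v =
          \sum_(0 <= v < N) v * \sum_(0 <= j < K) (v < N %/ 2 ^ j).
  under eq_bigr => j _ do rewrite sub ?leq_div //.
  by rewrite exchange_big; apply: eq_bigr => v _; rewrite big_distrr.
have E2 : \sum_(0 <= v < N) v * \sum_(1 <= k < K) (N %/ 2 ^ k <= v < break k) <=
    \sum_(1 <= k < K) \sum_(N %/ 2 ^ k <= v < break k) v.
  under eq_bigr => v _ do rewrite big_distrr /=.
  by rewrite exchange_big /=; apply: leq_sum => k _; exact: sub2.
have E3 : \sum_(0 <= v < N) v * (v < 4) * (3 * K.+1) <= 18 * K.+1.
  rewrite -big_distrl /= -(sub 4) //.
  by rewrite !big_nat_recr //= big_nil; lia.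
rewrite E1; apply: leq_trans (leq_add (leq_add (leqnn _) E2) E3).
rewrite -!big_split /= big_seq [X in _ <= X]big_seq.
apply: leq_sum => v; rewrite mem_index_iota => /andP[_ vN].
rewrite [merge_base * v]mulnC -mulnDr [K * v]mulnC -!mulnA -!mulnDr leq_mul2l.
have [->//|v0] := posnP v.
apply/orP; right; case: (ltnP v 4) => v4.
  have := @cost_small_crude v ltac:(lia).
  have : merge_base <= 3 by rewrite /merge_base; case: ifP.
  by rewrite mul1n; lia.
by rewrite mul0n addn0; apply: cost_small_le; rewrite v4.
Qed.

End SmallCost.

Local Open Scope ring_scope.

(** * The cost of inserting a pair *)

Section Sums.
Variable R : realType.

Lemma natr_sum_id (n : nat) : (\sum_(0 <= v < n) v)%N%:R = n%:R * (n%:R - 1) / 2 :> R.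
Proof.
elim: n => [|n IH]; first by rewrite big_nil; ring.
by rewrite big_nat_recr //= natrD IH -natr1; field.
Qed.

Lemma natr_sum_range (m n : nat) : (m <= n)%N ->
  (\sum_(m <= v < n) v)%N%:R = (n%:R * (n%:R - 1) - m%:R * (m%:R - 1)) / 2 :> R.
Proof.
move=> mn; have := natr_sum_id n.
by rewrite (big_cat_nat (n := m)) //= natrD natr_sum_id; lra.
Qed.

Lemma sum_geometric (a b : R) (K : nat) : 0 <= a -> 0 <= b ->
  \sum_(1 <= k < K) (a / 4 ^+ k + b / 2 ^+ k) <= a / 3 + b.
Proof.
move=> a0 b0; suff : \sum_(1 <= k < K.+1) (a / 4 ^+ k + b / 2 ^+ k) =
    a / 3 * (1 - (4 ^+ K)^-1) + b * (1 - (2 ^+ K)^-1).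
  case: K => [_|K]; first by rewrite big_geq //; lra.
  rewrite big_nat_recr //= => E.
  have h4 : 0 <= (4 ^+ K.+1)^-1 :> R by rewrite invr_ge0 exprn_ge0.
  have h2 : 0 <= (2 ^+ K.+1)^-1 :> R by rewrite invr_ge0 exprn_ge0.
  by move: E; nra.
elim: K => [|K IH]; first by rewrite big_geq // !expr0 invr1; ring.
rewrite big_nat_recr //= IH !exprS.
have : (2 ^+ K : R) != 0 by rewrite expf_neq0 // pnatr_eq0.
have : (4 ^+ K : R) != 0 by rewrite expf_neq0 // pnatr_eq0.
by move=> h1 h2; field; rewrite h1 h2.
Qed.

(** At a power of 2 the formulas of the two adjacent levels agree, so both ends are allowed and
    [N - 1] and [N] can share one [k]. *)
Lemma natr_path_len (k L : nat) : (2 ^ k <= L <= 2 ^ k.+1)%N ->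
  (path_len L)%:R = L%:R * (k%:R + 2) - 2 * 2 ^+ k :> R.
Proof.
case/andP => kL Lk; have k0 : (0 < 2 ^ k)%N by rewrite expn_gt0.
have -> : path_len L = (L * k.+2 - 2 ^ k.+1)%N.
  rewrite /path_len; move: kL; rewrite leq_eqVlt => /predU1P[<-|kL].
    by rewrite clg_pow2 expnS; nia.
  by rewrite (clgP L k) // kL.
rewrite natrB; last by rewrite expnS; nia.
by rewrite natrM natrX exprS -addn2 natrD.
Qed.

(** The terms without [m] are fixed by the agreement of the formulas for [k] and [k.+1] at
    [m = 2 ^ k.+1]. *)
Lemma natr_sum_path_len (m k : nat) : (0 < m)%N -> (2 ^ k <= m <= 2 ^ k.+1)%N ->
  (\sum_(1 <= L < m.+1) path_len L)%N%:R =
  (k%:R + 2) * m%:R * (m%:R + 1) / 2 - 2 * m%:R * 2 ^+ k +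
  (4 * 2 ^+ k * 2 ^+ k - 1) / 6 - (2 * 2 ^+ k - 1) / 2 :> R.
Proof.
elim: m k => // m IH k _ /andP[km mk].
case: m IH km mk => [|m] IH km mk.
  have -> : k = 0%N by case: k km {mk} => // k; rewrite expnS; have := expn_gt0 2 k; lia.
  have e1 : path_len 1 = 0%N by rewrite /path_len /clg up_log1.
  by rewrite big_nat1 e1 !expr0; field.
rewrite big_nat_recr //= natrD.
move: km; rewrite leq_eqVlt => /predU1P[km|km]; last first.
  rewrite (IH k) //; last by apply/andP; split=> //; exact: ltnW.
  by rewrite (natr_path_len k) ?(ltnW km) ?mk // -[m.+2%:R]natr1; field.
case: k km {mk} => [|k] km; first by rewrite expn0 in km.
have k0 : (0 < 2 ^ k)%N by rewrite expn_gt0.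
rewrite (IH k) //; last by move: km; rewrite !expnS; lia.
rewrite (natr_path_len k); last by rewrite -km leqnn andbT expnS; lia.
have -> : m.+1%:R = 2 ^+ k.+1 - 1 :> R by rewrite -natrX km -natr1; ring.
by rewrite -km natrX -[k.+1%:R]natr1 !exprS; field.
Qed.

End Sums.

Section StepSum.
Variables (R : realType) (N : nat).
Hypothesis N4 : (4 <= N)%N.
Let K := clg N.
Let n : R := N%:R.
Let h : R := 2 ^+ K.
Let b := merge_base N.
(** Up to rounding, [break N k] is [3 (n - theta h) / 2 ^ k]. *)
Let theta : R := (2 ^+ b.-1)^-1.

Lemma clg_pred : exists k, [/\ K = k.+1, (2 ^ k < N)%N & (N <= 2 ^ k.+1)%N].
Proof.
have [|k [E /andP[kN Nk]]] := clg_bounds N; first by lia.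
by exists k.
Qed.

Lemma h_bounds : n <= h /\ h < 2 * n.
Proof.
have [k [E kN Nk]] := clg_pred; rewrite /h /n E -natrX ler_nat; split=> //.
by rewrite -natrM ltr_nat expnS ltn_pmul2l.
Qed.

Lemma n_ge4 : 4 <= n. Proof. by rewrite /n ler_nat. Qed.

Lemma clg_succ_le : K.+1%:R <= n.
Proof.
have [k [-> kN _]] := clg_pred; rewrite ler_nat.
by have := ltn_expl k (isT : (1 < 2)%N); lia.
Qed.

Lemma step_sum_plain : ~~ use_merge R N ->
  (step_sum R N)%:R <= n * (n - 1) * (2 * K%:R + 2 - 2 * h / n).
Proof.
move=> um; rewrite /step_sum (negPf um).
have [k [E kN Nk]] := clg_pred; have [_ h2] := h_bounds; have n4 := n_ge4.
rewrite natrD !natrM (natr_path_len R k); last by lia.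
rewrite (natr_path_len R k); last by lia.
have -> : N.-1%:R = n - 1 :> R by rewrite /n -subn1 natrB //; lia.
rewrite -/n E -[k.+1%:R]natr1.
have hE : h = 2 * 2 ^+ k by rewrite /h E exprS.
have := pow2_gt0 R k; move: n4; rewrite hE.
move: (n) (k%:R) (2 ^+ k) => x y z x4 z0; clear E.
have -> : x * (x - 1) * (2 * (y + 1) + 2 - 2 * (2 * z) / x) =
  x * (x - 1) * (2 * y + 4) - 4 * z * (x - 1) by field; lra.
by lra.
Qed.

(** The last inequality amounts to [n <= 3 (n - theta h)]: up to rounding, no break precedes the
    start [n / 2 ^ k] of its interval. *)
Lemma theta_bounds : [/\ 0 < theta, theta * h <= n & 3 * theta * h <= 2 * n].
Proof.
have [h1 h2] := h_bounds; have n4 := n_ge4.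
rewrite /theta /b /merge_base; case: ltnP => c.
  have : 3 * h < 4 * n by rewrite /h -natrX -!natrM ltr_nat.
  by rewrite expr1; split; lra.
by rewrite /= expr2; split; lra.
Qed.

Lemma sum_break_le (k : nat) : (0 < k < K)%N ->
  2 * (\sum_(N %/ 2 ^ k <= v < break N k) v)%N%:R <=
  (9 * (n - theta * h) ^+ 2 - n ^+ 2) / 4 ^+ k + (6 * (n - theta * h) + 2 * n) / 2 ^+ k.
Proof.
move=> /andP[k0 kK]; have [t0 th1 th2] := theta_bounds; have n4 := n_ge4.
set s : R := 2 ^+ k; have s0 : 0 < s := pow2_gt0 R k.
pose X := n / s; pose Z := theta * h / s.
have nX : n = X * s by rewrite /X divfK // gt_eqF.
have hZ : theta * h = Z * s by rewrite /Z divfK // gt_eqF.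
have -> : 4 ^+ k = s ^+ 2 :> R.
  by rewrite /s -exprM mulnC exprM; congr (_ ^+ _); ring.
have -> : (9 * (n - theta * h) ^+ 2 - n ^+ 2) / s ^+ 2 + (6 * (n - theta * h) + 2 * n) / s =
          9 * (X - Z) ^+ 2 - X ^+ 2 + 6 * (X - Z) + 2 * X.
  by rewrite hZ nX; field; rewrite gt_eqF.
have XZ : X <= 3 * (X - Z).
  suff : 3 * Z <= 2 * X by lra.
  rewrite -(ler_pM2r s0); move: th2; rewrite -mulrA hZ nX.
  by rewrite !mulrA.
have X1 : 1 <= X.
  rewrite /X ler_pdivlMr // mul1r /s /n -natrX ler_nat.
  have [k' [E k'N _]] := clg_pred; apply: leq_trans (ltnW k'N).
  by rewrite leq_exp2l //; rewrite E in kK.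
case: (leqP (break N k) (N %/ 2 ^ k)) => [le|lt].
  by rewrite big_geq // mulr0; nra.
rewrite natr_sum_range ?(ltnW lt) //.
set B := break N k in lt *; set D := (N %/ 2 ^ k)%N in lt *.
have DX : D%:R <= X by rewrite ler_pdivlMr // /s /n -natrX -natrM ler_nat leq_divM.
have XD : X <= D%:R + 1.
  rewrite ler_pdivrMr // natr1 /s /n -natrX -natrM ler_nat ltnW //.
  by rewrite -ltn_divLR ?expn_gt0.
have x2 : (N %/ 2 ^ k.-1)%:R <= 2 * X.
  rewrite /X mulrA ler_pdivlMr // /s -(prednK k0) exprS mulrCA ler_pM2l //.
  by rewrite /n -natrX -natrM ler_nat leq_divM.
pose e := (K - (k + b - 1))%N.
(* If the subtraction in [e] is truncated, [2 ^ e] only gets larger than [Z]. *)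
have EZ : Z <= 2 ^+ e.
  rewrite ler_pdivrMr // /theta mulrC ler_pdivrMr ?pow2_gt0 // /h /s -!exprD.
  apply: ler_weXn2l; first by rewrite ler1n.
  have : (0 < b)%N by [rewrite /b /merge_base; case: ifP].
  by rewrite /e; clear; lia.
have BE : (B + D + 3 * 2 ^ e = 2 * (N %/ 2 ^ k.-1))%N.
  by move: lt; rewrite /B /break -/K -/b -/e -/D; clear; lia.
have BR : B%:R = 2 * (N %/ 2 ^ k.-1)%:R - D%:R - 3 * 2 ^+ e :> R.
  have := congr1 (fun i => i%:R : R) BE; rewrite /= !natrD natrX; lra.
have BD : D%:R <= B%:R :> R by rewrite ler_nat ltnW.
have D0 : 0 <= D%:R :> R by rewrite ler0n.
(* The summand 1 comes from rounding [D] down, as [D] enters [B] with a minus sign. *)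
have Bu : B%:R <= 3 * (X - Z) + 1 by lra.
have B2 : B%:R ^+ 2 <= (3 * (X - Z) + 1) ^+ 2 by rewrite ler_sqr ?nnegrE //; lra.
have D2 : (X - 1) ^+ 2 <= D%:R ^+ 2 by rewrite ler_sqr ?nnegrE //; lra.
move: B2 D2 BD; rewrite !expr2; lra.
Qed.

Lemma sum_levels_le :
  2 * (\sum_(0 <= j < K) \sum_(0 <= v < N %/ 2 ^ j) v)%N%:R <= n * (n - 1) + n ^+ 2 / 3.
Proof.
have [k [E _ _]] := clg_pred; rewrite big_ltn ?E // -E expn0 divn1 natrD natr_sum_id -/n.
clear E; rewrite mulrDr natr_sum big_distrr /=.
suff : \sum_(1 <= j < K) 2 * (\sum_(0 <= v < N %/ 2 ^ j) v)%N%:R <= n ^+ 2 / 3 by lra.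
rewrite -[X in _ <= X]addr0; apply: le_trans (sum_geometric R _ _ K (sqr_ge0 n) (lexx 0)).
apply: ler_sum_nat => j _; rewrite natr_sum_id mul0r addr0.
set s : R := 2 ^+ j; have s0 : 0 < s := pow2_gt0 R j.
have -> : 4 ^+ j = s ^+ 2 :> R.
  by rewrite /s -exprM mulnC exprM; congr (_ ^+ _); ring.
rewrite -expr_div_n; set D := (N %/ 2 ^ j)%N.
have DX : D%:R <= n / s by rewrite ler_pdivlMr // /s /n -natrX -natrM ler_nat leq_divM.
have D0 : 0 <= D%:R :> R by rewrite ler0n.
have : D%:R ^+ 2 <= (n / s) ^+ 2 by rewrite ler_sqr ?nnegrE // (le_trans D0).
by rewrite !expr2; lra.
Qed.

(** In [44 * n], [36 n] covers twice [18 * K.+1], by [K.+1 <= n], and [8 n] the linear terms from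
    the breaks. *)
Lemma step_sum_merge : use_merge R N ->
  (step_sum R N)%:R <= n * (n - 1) * (2 * K%:R + 3 - b%:R) + 3 * (n - theta * h) ^+ 2
    - 2 * (n - 1) * h + h ^+ 2 / 3 + 44 * n.
Proof.
move=> um; rewrite /step_sum um.
have [k [E kN Nk]] := clg_pred.
have N0 : (0 < N)%N by exact: leq_trans N4.
have P1 : (0 < N.-1)%N by move: N4; clear; lia.
have P2 : (2 ^ k <= N.-1 <= 2 ^ k.+1)%N by move: kN Nk N0; clear; lia.
have NE : N.-1%:R = n - 1 :> R by rewrite /n -subn1 natrB.
have [h1 h2] := h_bounds; have n4 := n_ge4.
have K1 := clg_succ_le; have [t0 th1 th2] := theta_bounds.
have HA := sum_cost_small R N N4.
rewrite -(ler_nat R) !natrD !natrM natr_sum_id -/K -/b -/n in HA; move: HA.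
set A := (\sum_(0 <= g < _) _)%N; set S1 := (\sum_(0 <= j < K) _)%N.
set S2 := (\sum_(1 <= k < K) _)%N => HA.
have HS1 : 2 * S1%:R <= n * (n - 1) + n ^+ 2 / 3 := sum_levels_le.
have HS2 : 2 * S2%:R <= (9 * (n - theta * h) ^+ 2 - n ^+ 2) / 3 +
    (6 * (n - theta * h) + 2 * n).
  rewrite /S2 natr_sum big_distrr /=; apply: le_trans (sum_geometric R _ _ K _ _).
  - by apply: ler_sum_nat => j /andP[j0 jK]; apply: sum_break_le; rewrite j0.
  - have : n ^+ 2 <= (3 * (n - theta * h)) ^+ 2 by rewrite ler_sqr ?nnegrE //; lra.
    by rewrite exprMn; lra.
  - by lra.
rewrite mul2n -addnn big_split /= natrD.
have -> : (\sum_(0 <= g < N.-1) path_len (N - 1 - g) = \sum_(1 <= L < N) path_len L)%N.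
  rewrite big_nat_rev /= add0n [RHS]big_add1; apply: eq_big_nat => g gN.
  by congr path_len; move: gN; clear; lia.
have -> : (\sum_(0 <= g < N.-1) (N - 1 - g) * (1 + cost_small R N g) =
           \sum_(0 <= v < N) v + A)%N.
  rewrite /A; under eq_bigr => g _ do rewrite mulnDr muln1.
  rewrite big_split /= [in RHS]big_ltn // add0n.
  congr (_ + _)%N; rewrite big_nat_rev /= add0n [RHS]big_add1; apply: eq_big_nat => g gN.
  by move: gN; clear; lia.
rewrite !natrD natr_sum_id -/n.
have := natr_sum_path_len R N.-1 k; rewrite prednK // => -> //.
rewrite NE.
have hE : h = 2 * 2 ^+ k by rewrite /h E exprS.
have KE : K%:R = k%:R + 1 :> R by rewrite E natr1.
rewrite -[K.+1%:R]natr1 KE in HA K1 *.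
move: HA HS1 HS2.
have hh : h ^+ 2 = 4 * 2 ^+ k * 2 ^+ k by rewrite hE expr2; clear E; ring.
have t0' : 0 < theta * h by rewrite mulr_gt0 // pow2_gt0.
have h0 : 0 < 2 ^+ k :> R := pow2_gt0 R k.
rewrite -hh.
have -> : 2 ^+ k = h / 2 by rewrite hE; clear E; field.
clear E; lra.
Qed.

End StepSum.

(** * Average cost of a pair as a function of [p] *)

Section StepAverage.
Variables (R : realType) (N : nat).
Hypothesis N4 : (4 <= N)%N.
Let n : R := N%:R.
(** [q] is [1 / p]; the functions [g1], [g2], [g3] are polynomials in it. *)
Let q : R := 2 ^+ clg N / n.

Lemma pp_inv : pp R N * q = 1 /\ 0 < q.
Proof.
have n4 := n_ge4 R N N4; rewrite /q /pp natrX -/n.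
have h0 := pow2_gt0 R (clg N).
split; last by rewrite divr_gt0 //; lra.
by rewrite mulrA divfK ?divff // gt_eqF //; lra.
Qed.

Lemma step_avg_plain : ~~ use_merge R N ->
  (step_sum R N)%:R / (n * (n - 1)) <= 2 * (clg N)%:R + 2 - 2 * q.
Proof.
move=> um; have n4 := n_ge4 R N N4; rewrite -/n in n4.
rewrite ler_pdivrMr; last by apply: mulr_gt0; lra.
by have := step_sum_plain R N N4 um; rewrite -/n -[2 * _ / n]mulrA -/q mulrC.
Qed.

(** Replacing [n ^ 2] by [n (n - 1)] in the main term adds at most [3 n] to the error [44 n], and
    [47 n <= 66 (n - 1)] for [4 <= n]. *)
Lemma step_avg_merge : use_merge R N ->
  (step_sum R N)%:R / (n * (n - 1)) <= 2 * (clg N)%:R + 66 / n +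
    (if (3 * 2 ^ clg N < 4 * N)%N then 4 - 5 * q + 13 / 12 * q ^+ 2
     else 3 - 7 / 2 * q + 25 / 48 * q ^+ 2).
Proof.
move=> um; have n4 := n_ge4 R N N4; rewrite -/n in n4.
rewrite ler_pdivrMr; last by apply: mulr_gt0; lra.
have := step_sum_merge R N N4 um; have [_ hn] := h_bounds R N N4.
have h0 := pow2_gt0 R (clg N).
have hq : 2 ^+ clg N = q * n by rewrite /q divfK // gt_eqF //; lra.
have q2 : 0 < q < 2.
  by rewrite divr_gt0 //=; [rewrite ltr_pdivrMr //; lra | lra].
case/andP: q2 => q0 q2.
have qq : q ^+ 2 <= 2 * q by rewrite expr2; nra.
have qq0 : 0 < q ^+ 2 by rewrite exprn_gt0.
set lhs := (step_sum _ _)%:R; rewrite -/n /merge_base; clearbody q.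
move: (n) n4 hn hq lhs => x x4 _ -> s; set c := (clg N)%:R.
have x1 g : (2 * c + 66 / x + g) * (x * (x - 1)) =
  2 * c * (x * (x - 1)) + 66 * (x - 1) + g * (x * (x - 1)) by field; lra.
case: ifP => _ /= H; apply: le_trans H _; rewrite x1 ?expr1 ?expr2.
  have -> : 3 * ((x - 2^-1 * (q * x)) * (x - 2^-1 * (q * x))) =
    (3 - 3 * q + 3 / 4 * q ^+ 2) * x ^+ 2 by field.
  have : 0 <= x * (3 * q - 13 / 12 * q ^+ 2) by apply: mulr_ge0; lra.
  by rewrite !expr2; lra.
have -> : 3 * ((x - (2 * 2)^-1 * (q * x)) * (x - (2 * 2)^-1 * (q * x))) =
  (3 - 3 / 2 * q + 3 / 16 * q ^+ 2) * x ^+ 2 by field.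
have : 0 <= x * (3 / 2 * q - 25 / 48 * q ^+ 2) by apply: mulr_ge0; lra.
by rewrite !expr2; lra.
Qed.

(** The polynomial is [g3 - g1 = 2 q^2 ((p - 3/4)^2 - 1/48)], whose root above [3 / 4] is the upper
    threshold. So the test selects the cheaper option. *)
Lemma use_merge_hi : (3 * 2 ^ clg N < 4 * N)%N ->
  use_merge R N = (2 - 3 * q + 13 / 12 * q ^+ 2 <= 0).
Proof.
rewrite -(pp_gt34 R) => p34; have [pq q0] := pp_inv; rewrite /use_merge.
move: (pp R N) p34 pq => p p34 pq; clearbody q.
have s3 : Num.sqrt 3 ^+ 2 = 3 :> R by rewrite sqr_sqrtr.
have s30 : 0 <= Num.sqrt 3 :> R by rewrite sqrtr_ge0.
have -> : 3 / 4 - Num.sqrt 6 / 12 <= p.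
  by have := sqrtr_ge0 (6 : R); lra.
have -> : 2 - 3 * q + 13 / 12 * q ^+ 2 = q ^+ 2 * 2 * ((p - 3 / 4) ^+ 2 - 1 / 48).
  have -> : q ^+ 2 * 2 * ((p - 3 / 4) ^+ 2 - 1 / 48) =
    2 * (p * q) ^+ 2 - 3 * (p * q) * q + 13 / 12 * q ^+ 2 by field.
  by rewrite pq expr1n; ring.
rewrite pmulr_rle0; last by apply: mulr_gt0 => //; exact: exprn_gt0.
have -> : 1 / 48 = (Num.sqrt 3 / 12) ^+ 2 :> R by rewrite expr_div_n s3; field.
by rewrite subr_le0 ler_sqr ?nnegrE //=; [rewrite lerBlDl | lra | lra].
Qed.

(** Likewise [g2 - g1 = q^2 ((3/4 - p)^2 - 1/24)], with the lower threshold as its root below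
    [3 / 4]. *)
Lemma use_merge_lo : (4 * N <= 3 * 2 ^ clg N)%N ->
  use_merge R N = (1 - 3 / 2 * q + 25 / 48 * q ^+ 2 <= 0).
Proof.
rewrite leqNgt -(pp_gt34 R) -leNgt => p34; have [pq q0] := pp_inv; rewrite /use_merge.
move: (pp R N) p34 pq => p p34 pq; clearbody q.
have s3 : Num.sqrt 6 ^+ 2 = 6 :> R by rewrite sqr_sqrtr.
have s30 : 0 <= Num.sqrt 6 :> R by rewrite sqrtr_ge0.
have -> : p <= 3 / 4 + Num.sqrt 3 / 12.
  by have := sqrtr_ge0 (3 : R); lra.
rewrite andbT.
have -> : 1 - 3 / 2 * q + 25 / 48 * q ^+ 2 = q ^+ 2 * ((3 / 4 - p) ^+ 2 - 1 / 24).
  have -> : q ^+ 2 * ((3 / 4 - p) ^+ 2 - 1 / 24) =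
    (p * q) ^+ 2 - 3 / 2 * (p * q) * q + 25 / 48 * q ^+ 2 by field.
  by rewrite pq expr1n; ring.
rewrite pmulr_rle0; last exact: exprn_gt0.
have -> : 1 / 24 = (Num.sqrt 6 / 12) ^+ 2 :> R by rewrite expr_div_n s3; field.
by rewrite subr_le0 ler_sqr ?nnegrE //=; [apply/idP/idP; lra | lra | lra].
Qed.

(** Where merging is chosen, it is no dearer than [g1]; this bound therefore holds for every [p] and
    makes the irrational thresholds disappear. *)
Lemma step_avg_le1 :
  (step_sum R N)%:R / (n * (n - 1)) <= 2 * (clg N)%:R + (2 - 2 * q) + 66 / n.
Proof.
have n0 : 0 < 66 / n by have := n_ge4 R N N4; rewrite -/n => ?; rewrite divr_gt0 //; lra.
case: (boolP (use_merge R N)) => um; last by have := step_avg_plain um; lra.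
apply: le_trans (step_avg_merge um) _; case: ltnP => c.
  by rewrite use_merge_hi // in um; lra.
by rewrite use_merge_lo // in um; lra.
Qed.

Lemma step_avg_le2 : (4 * N <= 3 * 2 ^ clg N)%N ->
  (step_sum R N)%:R / (n * (n - 1)) <=
    2 * (clg N)%:R + (3 - 7 / 2 * q + 25 / 48 * q ^+ 2) + 66 / n.
Proof.
move=> c; case: (boolP (use_merge R N)) => um.
  by have := step_avg_merge um; rewrite ltnNge c /=; lra.
have n0 : 0 < 66 / n by have := n_ge4 R N N4; rewrite -/n => ?; rewrite divr_gt0 //; lra.
by have := step_avg_plain um; rewrite use_merge_lo // -ltNge in um; lra.
Qed.

Lemma step_avg_le3 : (3 * 2 ^ clg N < 4 * N)%N ->
  (step_sum R N)%:R / (n * (n - 1)) <=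
    2 * (clg N)%:R + (4 - 5 * q + 13 / 12 * q ^+ 2) + 66 / n.
Proof.
move=> c; case: (boolP (use_merge R N)) => um.
  by have := step_avg_merge um; rewrite c /=; lra.
have n0 : 0 < 66 / n by have := n_ge4 R N N4; rewrite -/n => ?; rewrite divr_gt0 //; lra.
by have := step_avg_plain um; rewrite use_merge_hi // -ltNge in um; lra.
Qed.

End StepAverage.

Section Average.
Variable R : realType.

Definition avg (m : nat) : R := (total_cost R m)%:R / ((2 * m).+2)`!%:R.

Lemma avgS (m : nat) (N := (2 * m.+1).+2) :
  avg m.+1 = avg m + (step_sum R N)%:R / (N%:R * (N%:R - 1)).
Proof.
have E2 : (2 * m.+1)`! = ((2 * m).+2)`! by rewrite mulnS.
rewrite /avg /N -E2 -[total_cost R m.+1]/((2 * m.+1).+2 * (2 * m.+1).+1 * total_cost R m +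
  (2 * m.+1)`! * step_sum R (2 * m.+1).+2)%N.
move: (2 * m.+1)%N (total_cost R m) => M t; clear N E2.
have f0 : (M`!%:R : R) != 0 by rewrite pnatr_eq0 -lt0n fact_gt0.
rewrite (factS M.+1) (factS M) natrD !natrM -[M.+2%:R]natr1.
have x0 : M.+1%:R != 0 :> R by rewrite pnatr_eq0.
have x1 : M.+1%:R + 1 != 0 :> R by rewrite natr1 pnatr_eq0.
move: (_`!%:R) t%:R (step_sum R _)%:R M.+1%:R f0 x0 x1 => F u s x F0 x0 x1.
by field; rewrite ?F0 ?x1 addrK x0.
Qed.

Lemma complexity_avg (m : nat) : complexity R (2 * m).+2 = avg m.
Proof.
rewrite /complexity /total_comps /avg; congr (_%:R / _).
rewrite sumnE big_map -(sum_ins12 R m (iota 0 (2 * m).+2)) ?iota_uniq ?size_iota //.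
by rewrite (_ : (2 * m).+2./2 = m.+1) //=; rewrite mul2n half_double.
Qed.

Lemma avg_le (m m' : nat) : (m <= m')%N -> avg m <= avg m'.
Proof.
move=> mm; rewrite -(subnK mm); elim: (_ - _)%N => // k IH.
rewrite addSn avgS; apply: le_trans IH _; rewrite lerDl divr_ge0 ?ler0n //.
by rewrite mulr_ge0 ?ler0n // subr_ge0 ler1n.
Qed.

End Average.

(** * Rational bounds on the logarithm *)

Import numFieldNormedType.Exports.

Section LnBounds.
Variable R : realType.

Lemma is_derive_ge0_le (f df : R -> R) (z : R) : 0 <= z ->
  (forall x, 0 <= x <= z -> is_derive x 1 f (df x)) ->
  (forall x, 0 <= x <= z -> 0 <= df x) -> f 0 <= f z.
Proof.
move=> z0 fdf df0.
have fd x : x \in `]0, z[%R -> is_derive x 1 f (df x).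
  by rewrite in_itv /= => /andP[x0 xz]; apply: fdf; rewrite !ltW.
have [|c /itvP cz E] := @MVT_segment R f df 0 z z0 fd.
  apply: derivable_within_continuous => x; rewrite in_itv /= => xz.
  by have [] := fdf x xz.
rewrite -subr_ge0 E mulr_ge0 ?subr0 // df0 //.
by rewrite !cz.
Qed.

Lemma is_derive_ln_ratio (x : R) : -1 < x < 1 ->
  is_derive x 1 (fun y : R => ln (1 + y) - ln (1 - y)) (2 / (1 - x ^+ 2)).
Proof.
move=> /andP[x1 x2].
have h1 : 0 < 1 + x by lra.
have h2 : 0 < 1 - x by lra.
have d1 := is_derive1_ln h1.
have d2 := is_derive1_ln h2.
have D1 : is_derive x 1 (@ln R \o (cst 1 + id)) ((1 + x)^-1 * (0 + 1)).
  exact: is_derive1_comp.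
have D2 : is_derive x 1 (@ln R \o (cst 1 - id)) ((1 - x)^-1 * (0 - 1)).
  exact: is_derive1_comp.
apply: (is_derive_eq (is_deriveB D1 D2)).
have -> : 1 - x ^+ 2 = (1 + x) * (1 - x) by ring.
by field; rewrite !gt_eqF.
Qed.

Lemma is_derive_powers (a b c x : R) :
  is_derive x 1 (fun y : R => 2 * (y + y ^+ 3 / a + y ^+ 5 / b + c * y ^+ 7))
    (2 * (1 + 3 * x ^+ 2 / a + 5 * x ^+ 4 / b + 7 * c * x ^+ 6)).
Proof.
have X n : is_derive x 1 (id ^+ n : R -> R) (n%:R * x ^+ n.-1).
  by apply: is_derive_eq; rewrite /GRing.scale /= mulr1.
have XZ n k : is_derive x 1 (k \*: (id ^+ n : R -> R)) (k * (n%:R * x ^+ n.-1)).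
  exact: is_deriveZ.
have D := is_deriveZ 2 (is_deriveD (is_deriveD (is_deriveD (X 1%N) (XZ 3%N a^-1))
  (XZ 5%N b^-1)) (XZ 7%N c)).
set f := (X in is_derive _ _ X _) in D.
have -> : (fun y : R => 2 * (y + y ^+ 3 / a + y ^+ 5 / b + c * y ^+ 7)) = f.
  apply/funext => y; rewrite /f !fctE.
  change (2 * (y + y ^+ 3 / a + y ^+ 5 / b + c * y ^+ 7) =
    2 * (y ^+ 1 + a^-1 * y ^+ 3 + b^-1 * y ^+ 5 + c * y ^+ 7)); ring.
apply: (is_derive_eq D).
change (2 * (1 * x ^+ 0 + a^-1 * (3 * x ^+ 2) + b^-1 * (5 * x ^+ 4) + c * (7 * x ^+ 6)) =
  2 * (1 + 3 * x ^+ 2 / a + 5 * x ^+ 4 / b + 7 * c * x ^+ 6)); ring.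
Qed.

(** The polynomial truncates the series of [ln ((1 + z) / (1 - z))]; the derivatives differ by the
    geometric tail [2 x^8 / (1 - x^2)]. *)
Lemma ln_ratio_ge (z : R) : 0 <= z < 1 ->
  2 * (z + z ^+ 3 / 3 + z ^+ 5 / 5 + 7^-1 * z ^+ 7) <= ln (1 + z) - ln (1 - z).
Proof.
move=> /andP[z0 z1].
pose u := fun y : R => ln (1 + y) - ln (1 - y).
pose v := fun y : R => 2 * (y + y ^+ 3 / 3 + y ^+ 5 / 5 + 7^-1 * y ^+ 7).
suff : (u - v) 0 <= (u - v) z.
  by rewrite !fctE /u /v !expr0n /= !mul0r mulr0 !addr0 subr0 ln1; lra.
apply: (is_derive_ge0_le (u - v) (fun x => 2 * x ^+ 8 / (1 - x ^+ 2)) z z0) => x /andP[x0 xz].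
  have D1 := @is_derive_ln_ratio x ltac:(lra).
  have D2 := is_derive_powers 3 5 7^-1 x.
  apply: (is_derive_eq (is_deriveB D1 D2)).
  have : 1 - x ^+ 2 != 0 by rewrite gt_eqF // subr_gt0 expr_lt1 //; lra.
  by move=> ?; field.
have x2 : 0 < 1 - x ^+ 2 by rewrite subr_gt0 expr_lt1 //; lra.
by rewrite divr_ge0 ?mulr_ge0 ?exprn_ge0 // ltW.
Qed.

(** The condition on [c] makes the derivative [14 c x^6] of the last term dominate the tail
    [2 x^6 / (1 - x^2)] on the whole interval. *)
Lemma ln_ratio_le (c z : R) : 0 <= z < 1 -> 1 <= 7 * c * (1 - z ^+ 2) ->
  ln (1 + z) - ln (1 - z) <= 2 * (z + z ^+ 3 / 3 + z ^+ 5 / 5 + c * z ^+ 7).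
Proof.
move=> /andP[z0 z1] cz.
pose u := fun y : R => ln (1 + y) - ln (1 - y).
pose v := fun y : R => 2 * (y + y ^+ 3 / 3 + y ^+ 5 / 5 + c * y ^+ 7).
suff : (v - u) 0 <= (v - u) z.
  by rewrite !fctE /u /v !expr0n /= !mul0r mulr0 !addr0 subr0 ln1; lra.
apply: (is_derive_ge0_le (v - u)
  (fun x => 2 * x ^+ 6 * (7 * c * (1 - x ^+ 2) - 1) / (1 - x ^+ 2)) z z0) => x /andP[x0 xz].
  have D1 := @is_derive_ln_ratio x ltac:(lra).
  have D2 := is_derive_powers 3 5 c x.
  apply: (is_derive_eq (is_deriveB D2 D1)).
  have : 1 - x ^+ 2 != 0 by rewrite gt_eqF // subr_gt0 expr_lt1 //; lra.
  by move=> ?; field.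
have x2 : 0 < 1 - x ^+ 2 by rewrite subr_gt0 expr_lt1 //; lra.
have xz2 : x ^+ 2 <= z ^+ 2 by rewrite ler_sqr ?nnegrE.
have z2 : 0 < 1 - z ^+ 2 by rewrite subr_gt0 expr_lt1 //; lra.
have c0 : 0 <= c by nra.
rewrite divr_ge0 ?mulr_ge0 ?exprn_ge0 ?(ltW x2) // subr_ge0 (le_trans cz) //.
by rewrite ler_wpM2l ?mulr_ge0 // lerD2l lerN2.
Qed.

End LnBounds.

(** * Values of the logarithm and comparison of densities *)

Section Numerics.
Variable R : realType.

Lemma ln_sub_ratio (a b z : R) : 0 < b -> b <= a -> z = (a - b) / (a + b) ->
  0 <= z < 1 /\ ln (1 + z) - ln (1 - z) = ln a - ln b.
Proof.
move=> b0 ba zE; have ab : 0 < a + b by lra.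
have z1 : 1 + z = 2 * a / (a + b) by rewrite zE; field; lra.
have z2 : 1 - z = 2 * b / (a + b) by rewrite zE; field; lra.
split.
  by apply/andP; split; rewrite zE; [rewrite divr_ge0 //; lra | rewrite ltr_pdivrMr //; lra].
by rewrite z1 z2 !ln_div ?lnM ?posrE ?mulr_gt0 //; lra.
Qed.

Lemma ln_sub_ge (a b z : R) : 0 < b -> b <= a -> z = (a - b) / (a + b) ->
  2 * (z + z ^+ 3 / 3 + z ^+ 5 / 5 + 7^-1 * z ^+ 7) <= ln a - ln b.
Proof. by move=> b0 ba zE; have [z01 <-] := ln_sub_ratio a b z b0 ba zE; exact: ln_ratio_ge. Qed.

(** For [z <= 1 / 3] the coefficient [c = 1 / 6] is admissible, since [7/6 * 8/9 >= 1]. *)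
Lemma ln_sub_le (a b z : R) : 0 < b -> b <= a -> z = (a - b) / (a + b) -> z <= 1 / 3 ->
  ln a - ln b <= 2 * (z + z ^+ 3 / 3 + z ^+ 5 / 5 + 6^-1 * z ^+ 7).
Proof.
move=> b0 ba zE z3; have [z01 <-] := ln_sub_ratio a b z b0 ba zE.
apply: ln_ratio_le => //; clear zE; case/andP: z01 => z0 z1.
have : z ^+ 2 <= (1 / 3) ^+ 2 by rewrite ler_sqr ?nnegrE //; lra.
by rewrite !expr2; lra.
Qed.

Lemma ln34_bounds :
  - ((287 + 683 / 1000) / 1000) <= ln (3 / 4 : R) <= - ((287 + 682 / 1000) / 1000).
Proof.
have ab : (0 : R) < 3 / 4 by lra.
have ab' : 3 / 4 <= 1 :> R by lra.
have zE : 1 / 7 = (1 - 3 / 4) / (1 + 3 / 4) :> R by field.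
have h1 := ln_sub_ge _ _ _ ab ab' zE.
have h2 := ln_sub_le _ _ _ ab ab' zE ltac:(lra).
rewrite ln1 in h1 h2; move: (ln _) h1 h2 => x h1 h2.
by apply/andP; split; lra.
Qed.

(** Passing through [3 / 4] replaces [z = 1/3] by the smaller ratios [1/5] and [1/7], where the
    polynomials are more accurate. *)
Lemma ln12_bounds :
  - ((693 + 149 / 1000) / 1000) <= ln (1 / 2 : R) <= - ((693 + (146 + 9 / 10) / 1000) / 1000).
Proof.
have ab : (0 : R) < 1 / 2 by lra.
have ab' : 1 / 2 <= 3 / 4 :> R by lra.
have zE : 1 / 5 = (3 / 4 - 1 / 2) / (3 / 4 + 1 / 2) :> R by field.
have h1 := ln_sub_ge _ _ _ ab ab' zE.
have h2 := ln_sub_le _ _ _ ab ab' zE ltac:(lra).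
have ab1 : (0 : R) < 3 / 4 by lra.
have ab1' : 3 / 4 <= 1 :> R by lra.
have zE1 : 1 / 7 = (1 - 3 / 4) / (1 + 3 / 4) :> R by field.
have h3 := ln_sub_ge _ _ _ ab1 ab1' zE1.
have h4 := ln_sub_le _ _ _ ab1 ab1' zE1 ltac:(lra).
rewrite ln1 in h3 h4; move: (ln (1 / 2)) (ln (3 / 4)) h1 h2 h3 h4 => x y h1 h2 h3 h4.
by apply/andP; split; lra.
Qed.

Lemma ln3564_bounds :
  - ((603 + 536 / 1000) / 1000) <= ln (35 / 64 : R) <= - ((603 + 535 / 1000) / 1000).
Proof.
have ab : (0 : R) < 35 / 64 by lra.
have ab' : 35 / 64 <= 3 / 4 :> R by lra.
have zE : 13 / 83 = (3 / 4 - 35 / 64) / (3 / 4 + 35 / 64) :> R by field.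
have h1 := ln_sub_ge _ _ _ ab ab' zE.
have h2 := ln_sub_le _ _ _ ab ab' zE ltac:(lra).
have ab1 : (0 : R) < 3 / 4 by lra.
have ab1' : 3 / 4 <= 1 :> R by lra.
have zE1 : 1 / 7 = (1 - 3 / 4) / (1 + 3 / 4) :> R by field.
have h3 := ln_sub_ge _ _ _ ab1 ab1' zE1.
have h4 := ln_sub_le _ _ _ ab1 ab1' zE1 ltac:(lra).
rewrite ln1 in h3 h4; move: (ln (35 / 64)) (ln (3 / 4)) h1 h2 h3 h4 => x y h1 h2 h3 h4.
by apply/andP; split; lra.
Qed.

Lemma ln5764_ge : - ((115 + (831 + 9 / 10) / 1000) / 1000) <= ln (57 / 64 : R).
Proof.
have ab : (0 : R) < 57 / 64 by lra.
have ab' : 57 / 64 <= 1 :> R by lra.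
have zE : 7 / 121 = (1 - 57 / 64) / (1 + 57 / 64) :> R by field.
have := ln_sub_le _ _ _ ab ab' zE ltac:(lra).
by rewrite ln1; move: (ln _) => x h; lra.
Qed.

Lemma ln2E : ln (2 : R) = - ln (1 / 2).
Proof. by rewrite div1r lnV ?posrE // opprK. Qed.

(* With [S := p + p0] and [D := p - p0], [2 (D / S + (D / S) ^+ 3 / 3)] bounds
   [ln (p / p0)] from below. *)
Lemma ln_ge_cubic (p0 p l : R) : 0 < p0 <= p -> l <= ln p0 ->
  l * (p + p0) ^+ 3 + 2 * (p - p0) * (p + p0) ^+ 2 + 2 / 3 * (p - p0) ^+ 3 <=
  ln p * (p + p0) ^+ 3.
Proof.
move=> p0p lp0; pose z := (p - p0) / (p + p0).
case/andP: p0p => p00 p0p.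
have := ln_sub_ge p p0 z p00 p0p erefl.
have [/andP[z0 _] _] := ln_sub_ratio p p0 z p00 p0p erefl.
have S0 : 0 < p + p0 by lra.
have -> : p - p0 = z * (p + p0) by rewrite /z divfK // gt_eqF.
clearbody z.
have z5 : 0 <= z ^+ 5 by exact: exprn_ge0.
have z7 : 0 <= z ^+ 7 by exact: exprn_ge0.
move=> H.
have -> : l * (p + p0) ^+ 3 + 2 * (z * (p + p0)) * (p + p0) ^+ 2 +
    2 / 3 * (z * (p + p0)) ^+ 3 = (l + 2 * (z + z ^+ 3 / 3)) * (p + p0) ^+ 3 by field.
by rewrite ler_pM2r ?exprn_gt0 //; lra.
Qed.

(* Since [ln p <= 0], an upper bound 1.442696 of [1 / ln 2] is what bounds [lg p]
   from below.  Decimals are nested because numerals are unary. *)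
Lemma density_le (a al be ga p0 l p : R) :
  0 < p0 <= p -> p <= 1 -> l <= ln p0 -> 0 <= be ->
  (a * p + (al + 2 * (1 + (403 + 4 / 10) / 1000)) * p ^+ 2 - ga) * (p + p0) ^+ 3 <=
    p * (2 * (1 + (442 + 696 / 1000) / 1000) * p + be) *
    (l * (p + p0) ^+ 3 + 2 * (p - p0) * (p + p0) ^+ 2 + 2 / 3 * (p - p0) ^+ 3) ->
  a + al * p - be * ln p - ga / p <= 2 * p * lg p - 2 * (1 + (403 + 4 / 10) / 1000) * p.
Proof.
move=> p0p p1 lp0 be0 H; have HL := ln_ge_cubic p0 p l p0p lp0.
case/andP: p0p => p00 p0p; have pp : 0 < p by lra.
have S0 : 0 < (p + p0) ^+ 3 by apply: exprn_gt0; lra.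
have w0 : 0 < p * (2 * (1 + (442 + 696 / 1000) / 1000) * p + be) by rewrite mulr_gt0 //; lra.
have H1 : a * p + (al + 2 * (1 + (403 + 4 / 10) / 1000)) * p ^+ 2 - ga <=
    p * (2 * (1 + (442 + 696 / 1000) / 1000) * p + be) * ln p.
  rewrite -(ler_pM2r S0); apply: le_trans H _; rewrite -[X in _ <= X]mulrA.
  by rewrite ler_pM2l.
have /andP[_ l2] := ln12_bounds; have l2E := ln2E.
have ln20 : 0 < ln (2 : R) by rewrite ln_gt0 // ltr1n.
have lp : ln p <= 0 by rewrite ln_le0.
have H2 : (1 + (442 + 696 / 1000) / 1000) * ln p <= lg p.
  rewrite /lg ler_pdivlMr // mulrAC.
  have e : 1 <= (1 + (442 + 696 / 1000) / 1000) * ln (2 : R).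
    by rewrite l2E; clear -l2; lra.
  have := ler_wnM2r lp e; clear; move: (ln p) (ln 2) => x y; lra.
rewrite -(ler_pM2l pp).
have -> : p * (a + al * p - be * ln p - ga / p) =
  a * p + al * p ^+ 2 - be * p * ln p - ga by field; rewrite gt_eqF.
have : p ^+ 2 * ((1 + (442 + 696 / 1000) / 1000) * ln p) <= p ^+ 2 * lg p.
  by rewrite ler_wpM2l ?exprn_ge0 // ltW.
move: H1; rewrite !expr2 => h1 h2; clear -h1 h2; lra.
Qed.

Lemma density_le1 (p : R) : 1 / 2 <= p -> p <= 35 / 64 ->
  - (4 + (791 + 529 / 1000) / 1000) + 2 * p - 2 * ln p - 0 / p <=
  2 * p * lg p - 2 * (1 + (403 + 4 / 10) / 1000) * p.
Proof.
move=> lp pr; have /andP[l0 _] := ln12_bounds.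
apply: (@density_le _ _ _ _ (1 / 2) (- ((693 + 149 / 1000) / 1000))) => //; try lra.
(* The difference has nonnegative coefficients in the Bernstein basis. *)
have b0 : 0 <= (p - 1 / 2) ^+ 0 * (35 / 64 - p) ^+ 6 by rewrite mulr_ge0 ?exprn_ge0 ?subr_ge0.
have b1 : 0 <= (p - 1 / 2) ^+ 1 * (35 / 64 - p) ^+ 5 by rewrite mulr_ge0 ?exprn_ge0 ?subr_ge0.
have b2 : 0 <= (p - 1 / 2) ^+ 2 * (35 / 64 - p) ^+ 4 by rewrite mulr_ge0 ?exprn_ge0 ?subr_ge0.
have b3 : 0 <= (p - 1 / 2) ^+ 3 * (35 / 64 - p) ^+ 3 by rewrite mulr_ge0 ?exprn_ge0 ?subr_ge0.
have b4 : 0 <= (p - 1 / 2) ^+ 4 * (35 / 64 - p) ^+ 2 by rewrite mulr_ge0 ?exprn_ge0 ?subr_ge0.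
have b5 : 0 <= (p - 1 / 2) ^+ 5 * (35 / 64 - p) ^+ 1 by rewrite mulr_ge0 ?exprn_ge0 ?subr_ge0.
have b6 : 0 <= (p - 1 / 2) ^+ 6 * (35 / 64 - p) ^+ 0 by rewrite mulr_ge0 ?exprn_ge0 ?subr_ge0.
lra.
Qed.

Lemma density_le2 (p : R) : 35 / 64 <= p -> p <= 3 / 4 ->
  - (5 + (291 + 324 / 1000) / 1000) + 3 * p - (7 / 2) * ln p - (25 / 48) / p <=
  2 * p * lg p - 2 * (1 + (403 + 4 / 10) / 1000) * p.
Proof.
move=> lp pr; have /andP[l0 _] := ln3564_bounds.
apply: (@density_le _ _ _ _ (35 / 64) (- ((603 + 536 / 1000) / 1000))) => //; try lra.
have b0 : 0 <= (p - 35 / 64) ^+ 0 * (3 / 4 - p) ^+ 6 by rewrite mulr_ge0 ?exprn_ge0 ?subr_ge0.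
have b1 : 0 <= (p - 35 / 64) ^+ 1 * (3 / 4 - p) ^+ 5 by rewrite mulr_ge0 ?exprn_ge0 ?subr_ge0.
have b2 : 0 <= (p - 35 / 64) ^+ 2 * (3 / 4 - p) ^+ 4 by rewrite mulr_ge0 ?exprn_ge0 ?subr_ge0.
have b3 : 0 <= (p - 35 / 64) ^+ 3 * (3 / 4 - p) ^+ 3 by rewrite mulr_ge0 ?exprn_ge0 ?subr_ge0.
have b4 : 0 <= (p - 35 / 64) ^+ 4 * (3 / 4 - p) ^+ 2 by rewrite mulr_ge0 ?exprn_ge0 ?subr_ge0.
have b5 : 0 <= (p - 35 / 64) ^+ 5 * (3 / 4 - p) ^+ 1 by rewrite mulr_ge0 ?exprn_ge0 ?subr_ge0.
have b6 : 0 <= (p - 35 / 64) ^+ 6 * (3 / 4 - p) ^+ 0 by rewrite mulr_ge0 ?exprn_ge0 ?subr_ge0.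
lra.
Qed.

Lemma density_le3 (p : R) : 3 / 4 <= p -> p <= 57 / 64 ->
  - (5 + (722 + 846 / 1000) / 1000) + 4 * p - 5 * ln p - (13 / 12) / p <=
  2 * p * lg p - 2 * (1 + (403 + 4 / 10) / 1000) * p.
Proof.
move=> lp pr; have /andP[l0 _] := ln34_bounds.
apply: (@density_le _ _ _ _ (3 / 4) (- ((287 + 683 / 1000) / 1000))) => //; try lra.
have b0 : 0 <= (p - 3 / 4) ^+ 0 * (57 / 64 - p) ^+ 6 by rewrite mulr_ge0 ?exprn_ge0 ?subr_ge0.
have b1 : 0 <= (p - 3 / 4) ^+ 1 * (57 / 64 - p) ^+ 5 by rewrite mulr_ge0 ?exprn_ge0 ?subr_ge0.
have b2 : 0 <= (p - 3 / 4) ^+ 2 * (57 / 64 - p) ^+ 4 by rewrite mulr_ge0 ?exprn_ge0 ?subr_ge0.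
have b3 : 0 <= (p - 3 / 4) ^+ 3 * (57 / 64 - p) ^+ 3 by rewrite mulr_ge0 ?exprn_ge0 ?subr_ge0.
have b4 : 0 <= (p - 3 / 4) ^+ 4 * (57 / 64 - p) ^+ 2 by rewrite mulr_ge0 ?exprn_ge0 ?subr_ge0.
have b5 : 0 <= (p - 3 / 4) ^+ 5 * (57 / 64 - p) ^+ 1 by rewrite mulr_ge0 ?exprn_ge0 ?subr_ge0.
have b6 : 0 <= (p - 3 / 4) ^+ 6 * (57 / 64 - p) ^+ 0 by rewrite mulr_ge0 ?exprn_ge0 ?subr_ge0.
lra.
Qed.

Lemma density_le4 (p : R) : 57 / 64 <= p -> p <= 1 ->
  - (4 + (810 + 473 / 1000) / 1000) + 2 * p - 2 * ln p - 0 / p <=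
  2 * p * lg p - 2 * (1 + (403 + 4 / 10) / 1000) * p.
Proof.
move=> lp pr; have l0 := ln5764_ge.
apply: (@density_le _ _ _ _ (57 / 64) (- ((115 + (831 + 9 / 10) / 1000) / 1000))) => //; try lra.
(* The margin is smallest near [p = 0.904]; the interval is cut close to this point, with one
   Bernstein basis on each half. *)
have [ps|/ltW ps] := lerP p (29 / 32).
  have b0 : 0 <= (p - 57 / 64) ^+ 0 * (29 / 32 - p) ^+ 6 by rewrite mulr_ge0 ?exprn_ge0 ?subr_ge0.
  have b1 : 0 <= (p - 57 / 64) ^+ 1 * (29 / 32 - p) ^+ 5 by rewrite mulr_ge0 ?exprn_ge0 ?subr_ge0.
  have b2 : 0 <= (p - 57 / 64) ^+ 2 * (29 / 32 - p) ^+ 4 by rewrite mulr_ge0 ?exprn_ge0 ?subr_ge0.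
  have b3 : 0 <= (p - 57 / 64) ^+ 3 * (29 / 32 - p) ^+ 3 by rewrite mulr_ge0 ?exprn_ge0 ?subr_ge0.
  have b4 : 0 <= (p - 57 / 64) ^+ 4 * (29 / 32 - p) ^+ 2 by rewrite mulr_ge0 ?exprn_ge0 ?subr_ge0.
  have b5 : 0 <= (p - 57 / 64) ^+ 5 * (29 / 32 - p) ^+ 1 by rewrite mulr_ge0 ?exprn_ge0 ?subr_ge0.
  have b6 : 0 <= (p - 57 / 64) ^+ 6 * (29 / 32 - p) ^+ 0 by rewrite mulr_ge0 ?exprn_ge0 ?subr_ge0.
  lra.
have b0 : 0 <= (p - 29 / 32) ^+ 0 * (1 - p) ^+ 6 by rewrite mulr_ge0 ?exprn_ge0 ?subr_ge0.
have b1 : 0 <= (p - 29 / 32) ^+ 1 * (1 - p) ^+ 5 by rewrite mulr_ge0 ?exprn_ge0 ?subr_ge0.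
have b2 : 0 <= (p - 29 / 32) ^+ 2 * (1 - p) ^+ 4 by rewrite mulr_ge0 ?exprn_ge0 ?subr_ge0.
have b3 : 0 <= (p - 29 / 32) ^+ 3 * (1 - p) ^+ 3 by rewrite mulr_ge0 ?exprn_ge0 ?subr_ge0.
have b4 : 0 <= (p - 29 / 32) ^+ 4 * (1 - p) ^+ 2 by rewrite mulr_ge0 ?exprn_ge0 ?subr_ge0.
have b5 : 0 <= (p - 29 / 32) ^+ 5 * (1 - p) ^+ 1 by rewrite mulr_ge0 ?exprn_ge0 ?subr_ge0.
have b6 : 0 <= (p - 29 / 32) ^+ 6 * (1 - p) ^+ 0 by rewrite mulr_ge0 ?exprn_ge0 ?subr_ge0.
lra.
Qed.

End Numerics.

(** * The potential *)

Section Potential.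
Variable R : realType.

(** Antiderivative of [al - be / p + ga / p^2], the common form of [g1], [g2], [g3], with constant
    of integration [a]. *)
Definition density (a al be ga p : R) : R := a + al * p - be * ln p - ga / p.

(** A step of 2 in [x] moves [p] by [2 / 2 ^ K]; the factor [2 ^ K / 2] makes the increment
    [2 K + g(p)] to first order. *)
Definition potential (a al be ga : R) (K : nat) (x : R) : R :=
  K%:R * x + 2 ^+ K / 2 * density a al be ga (x / 2 ^+ K).

(** The increment must dominate the derivative at the right end. This holds for the concave term
    [- ga / p]; for the convex term [- be * ln p] the defect is at most [be * 4 / x <= 20 / x]. *)
Lemma potential_step (a al be ga : R) (K : nat) (x : R) :
  0 <= be -> be <= 5 -> 0 <= ga -> 4 <= x -> 2 ^+ K <= 2 * (x - 2) ->
  potential a al be ga K (x - 2) +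
    (2 * K%:R + (al - be * (2 ^+ K / x) + ga * (2 ^+ K / x) ^+ 2)) <=
  potential a al be ga K x + 20 / x.
Proof.
move=> be0 be5 ga0 x4 hx; rewrite /potential /density.
have h0 := pow2_gt0 R K; move: (2 ^+ K) h0 hx => h h0 hx; set k := K%:R.
have [y yE] : exists y, y = x - 2 by exists (x - 2).
have y0 : 0 < y by lra.
have x0 : 0 < x by lra.
rewrite -yE; have hy : h <= 2 * y by lra.
have lnE : ln (x / h) - ln (y / h) <= 2 / y.
  have -> : x / h = y / h * (1 + 2 / y) by rewrite yE; field; rewrite -yE !gt_eqF.
  have ty : 0 < 2 / y by rewrite divr_gt0.
  rewrite lnM ?posrE; [|by rewrite divr_gt0|by lra].
  by have := @le_ln1Dx R (2 / y) ltac:(lra); lra.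
have bl : be * h / 2 * (ln (x / h) - ln (y / h)) <= be * h / 2 * (2 / y).
  by rewrite ler_wpM2l // divr_ge0 // mulr_ge0 // ltW.
have e1 : be * h / 2 * (2 / y) = be * (h / x) + be * (2 * h / (x * y)).
  by rewrite yE; field; rewrite -yE !gt_eqF.
have e2 : be * (2 * h / (x * y)) <= 20 / x.
  have -> : 20 / x = 5 * (4 / x) by field; rewrite gt_eqF.
  have p1 : 2 * h / (x * y) <= 4 / x.
    rewrite ler_pdivrMr ?mulr_gt0 //.
    have -> : 4 / x * (x * y) = 4 * y by field; rewrite gt_eqF.
    by lra.
  have p2 : 0 <= 2 * h / (x * y) by rewrite divr_ge0 ?mulr_ge0 // ltW.
  apply: le_trans (_ : be * (4 / x) <= _); first by rewrite ler_wpM2l.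
  by rewrite ler_wpM2r // divr_ge0 // ltW.
have e3 : ga * (h / x) ^+ 2 <= ga * (h ^+ 2 / (x * y)).
  rewrite ler_wpM2l // expr_div_n ler_wpM2l ?exprn_ge0 ?(ltW h0) //.
  by rewrite lef_pV2 ?posrE ?mulr_gt0 ?exprn_gt0 // expr2 ler_pM2l //; lra.
have e4 : h / 2 * (ga / (y / h)) - h / 2 * (ga / (x / h)) = ga * (h ^+ 2 / (x * y)).
  by rewrite yE; field; rewrite -yE !gt_eqF.
have e5 z : h / 2 * (al * (z / h)) = al * z / 2 by field; rewrite gt_eqF.
have := e5 x; have := e5 y.
move: (ln (x / h)) (ln (y / h)) bl => u v bl.
move: (ga / (y / h)) (ga / (x / h)) e4 => g1 g2 e4.
rewrite yE in e1 *; move=> e6 e7.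
move: (al * ((x - 2) / h)) (al * (x / h)) e6 e7 => w1 w2 e6 e7.
rewrite yE in bl e2 e3 e4.
lra.
Qed.

Lemma complexity_step (N : nat) : (4 <= N)%N -> ~~ odd N ->
  complexity R N = complexity R (N - 2) + (step_sum R N)%:R / (N%:R * (N%:R - 1)).
Proof.
move=> N4 oN; have [m ->] : exists m, N = (2 * m.+1).+2.
  exists (N./2 - 2)%N; have := odd_double_half N; rewrite (negPf oN) add0n => E.
  by rewrite -{1}E; lia.
rewrite complexity_avg avgS subSS subSS subn0.
by rewrite (_ : (2 * m.+1)%N = (2 * m).+2) ?complexity_avg // mulnS.
Qed.

Lemma complexity_ge0 (N : nat) : 0 <= complexity R N.
Proof. by rewrite /complexity divr_ge0 ?ler0n. Qed.

Lemma pow2_64 (K : nat) : (6 < K)%N -> (2 ^ K = 64 * 2 ^ (K - 6))%N.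
Proof. by move=> K6; rewrite -[64%N]/(2 ^ 6)%N -expnD subnKC // ltnW. Qed.

Variable C : R.

(** A step has error at most [(20 + 66) / N = 43 * (2 / N)], and [2 / N <= ln N - ln (N - 2)]; hence
    the term with 43. *)
Definition bounded (a al be ga : R) (K N : nat) : Prop :=
  complexity R N <= potential a al be ga K N%:R + 43 * ln (N%:R) + C.

(** Induction in steps of 2 from the left end. The ends are multiples of [2 ^ (K - 6)], that is [p]
    in 64ths, and they are even integers because [6 < K]. *)
Lemma bounded_piece (a al be ga : R) (K u1 u2 : nat) :
  (6 < K)%N -> (32 <= u1)%N -> (u2 <= 64)%N -> 0 <= be -> be <= 5 -> 0 <= ga ->
  (forall N, (4 <= N)%N -> clg N = K -> (u1 * 2 ^ (K - 6) < N <= u2 * 2 ^ (K - 6))%N ->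
     (step_sum R N)%:R / (N%:R * (N%:R - 1)) <= 2 * K%:R +
       (al - be * (2 ^+ K / N%:R) + ga * (2 ^+ K / N%:R) ^+ 2) + 66 / N%:R) ->
  bounded a al be ga K (u1 * 2 ^ (K - 6)) ->
  forall N, ~~ odd N -> (u1 * 2 ^ (K - 6) <= N <= u2 * 2 ^ (K - 6))%N ->
  bounded a al be ga K N.
Proof.
move=> K6 u1l u2l be0 be5 ga0 Hstep B0 N oN /andP[lN Nu].
have EK := pow2_64 K K6.
have EK1 : (2 ^ K.-1 = 32 * 2 ^ (K - 6))%N.
  by rewrite -[32%N]/(2 ^ 5)%N -expnD; congr (2 ^ _)%N; lia.
have EH : (2 ^ (K - 6) = 2 * 2 ^ (K - 7))%N.
  by rewrite -expnS; congr (2 ^ _)%N; lia.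
have H0 : (0 < 2 ^ (K - 7))%N by rewrite expn_gt0.
have [j jE] : exists j, N = (u1 * 2 ^ (K - 6) + 2 * j)%N.
  exists ((N - u1 * 2 ^ (K - 6))./2)%N.
  have e : odd (N - u1 * 2 ^ (K - 6)) = false.
    by rewrite oddB // (negPf oN) EH mulnCA oddM.
  have := odd_double_half (N - u1 * 2 ^ (K - 6)).
  by rewrite e add0n -mul2n => ->; rewrite subnKC.
elim: j N jE oN lN Nu => [|j IH] N jE oN lN Nu; first by rewrite jE muln0 addn0.
have lH : (32 * 2 ^ (K - 6) <= u1 * 2 ^ (K - 6))%N by rewrite leq_mul2r u1l orbT.
have uH : (u2 * 2 ^ (K - 6) <= 64 * 2 ^ (K - 6))%N by rewrite leq_mul2r u2l orbT.
have N2 : (N - 2 = u1 * 2 ^ (K - 6) + 2 * j)%N by move: jE; clear; lia.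
have l2 : (u1 * 2 ^ (K - 6) <= N - 2)%N by rewrite N2 leq_addr.
have lN' : (u1 * 2 ^ (K - 6) < N)%N by move: jE; clear; lia.
have N4 : (4 <= N)%N by move: lH lN EH H0; clear; lia.
have K0 : (0 < K)%N by exact: leq_trans K6.
have cK : clg N = K.
  rewrite -[RHS](prednK K0); apply: clgP.
  by rewrite (prednK K0) EK1 EK (leq_ltn_trans lH lN') (leq_trans Nu uH).
have := IH (N - 2)%N N2; rewrite oddB ?(negPf oN) //=; last by move: N4; clear; lia.
move=> /(_ isT l2 (leq_trans (leq_subr _ _) Nu)).
rewrite /bounded (complexity_step N N4 oN) natrB; last by move: N4; clear; lia.
have n4 : 4 <= N%:R :> R by rewrite ler_nat.
have := Hstep N N4 cK; rewrite lN' Nu => /(_ isT).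
have hx : 2 ^+ K <= 2 * (N%:R - 2) :> R.
  rewrite -natrX EK -[2]/(2%:R) -natrB; last by move: N4; clear; lia.
  by rewrite -natrM ler_nat; move: lH l2; clear; lia.
have := potential_step a al be ga K N%:R be0 be5 ga0 n4 hx.
move: N%:R n4 => x x4.
have : ln (x - 2) - ln x <= - (2 / x).
  have x0 : 0 < x by lra.
  have t1 : 2 / x < 1 by rewrite ltr_pdivrMr //; lra.
  have := @le_ln1Dx R (- (2 / x)) ltac:(lra).
  have -> : 1 + - (2 / x) = (x - 2) / x by field; rewrite gt_eqF.
  by rewrite ln_div ?posrE //; lra.
have -> : 20 / x = 10 * (2 / x) by field; lra.
have -> : 66 / x = 33 * (2 / x) by field; lra.
move: (2 / x) (_ / (x * (x - 1))) => t st.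
move: (complexity R _) (al - _ + _) (potential _ _ _ _ _ (x - 2)) => c d q.
by move: (potential _ _ _ _ _ _) (ln _) (ln _) => *; lra.
Qed.

Lemma bounded_le (a al be ga a' al' be' ga' : R) (K u : nat) : (6 < K)%N ->
  density a al be ga (u%:R / 64) <= density a' al' be' ga' (u%:R / 64) ->
  bounded a al be ga K (u * 2 ^ (K - 6)) -> bounded a' al' be' ga' K (u * 2 ^ (K - 6)).
Proof.
move=> K6 d B; apply: le_trans B _; rewrite !lerD2r /potential lerD2l.
have -> : (u * 2 ^ (K - 6))%:R / 2 ^+ K = u%:R / 64 :> R.
  have -> : 2 ^+ K = 64 * 2 ^+ (K - 6) :> R.
    by rewrite -{1}(subnKC (ltnW K6)) exprD; congr (_ * _); ring.
  rewrite natrM natrX; have := pow2_gt0 R (K - 6).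
  by move: (2 ^+ _) => h h0; field; rewrite gt_eqF.
by rewrite ler_wpM2l // divr_ge0 // ltW // pow2_gt0.
Qed.

(** The constants glue the four pieces at [35/64], [3/4] and [57/64], and the passage from [p = 1]
    to [p = 1/2] in the next octave closes the cycle and determines them, up to rounding. *)
Let a1 : R := - (4 + (791 + 529 / 1000) / 1000).
Let a2 : R := - (5 + (291 + 324 / 1000) / 1000).
Let a3 : R := - (5 + (722 + 846 / 1000) / 1000).
Let a4 : R := - (4 + (810 + 473 / 1000) / 1000).

Lemma bounded_octave (K : nat) : (6 < K)%N ->
  bounded a1 2 2 0 K (32 * 2 ^ (K - 6)) ->
  [/\ forall N, ~~ odd N -> (32 * 2 ^ (K - 6) <= N <= 35 * 2 ^ (K - 6))%N ->
        bounded a1 2 2 0 K N,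
      forall N, ~~ odd N -> (35 * 2 ^ (K - 6) <= N <= 48 * 2 ^ (K - 6))%N ->
        bounded a2 3 (7 / 2) (25 / 48) K N,
      forall N, ~~ odd N -> (48 * 2 ^ (K - 6) <= N <= 57 * 2 ^ (K - 6))%N ->
        bounded a3 4 5 (13 / 12) K N &
      forall N, ~~ odd N -> (57 * 2 ^ (K - 6) <= N <= 64 * 2 ^ (K - 6))%N ->
        bounded a4 2 2 0 K N].
Proof.
move=> K6 B1.
have oH u : ~~ odd (u * 2 ^ (K - 6)).
  by rewrite oddM oddX /= (_ : (K - 6 == 0)%N = false) ?andbF //; lia.
have le u v : (u <= v)%N -> (u * 2 ^ (K - 6) <= v * 2 ^ (K - 6))%N.
  by move=> uv; rewrite leq_mul2r uv orbT.
have P1 : forall N, ~~ odd N -> (32 * 2 ^ (K - 6) <= N <= 35 * 2 ^ (K - 6))%N ->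
    bounded a1 2 2 0 K N.
  apply: bounded_piece B1 => //; try lra.
  by move=> N N4 cK _; have := step_avg_le1 R N N4; rewrite cK mul0r addr0.
have B2 : bounded a2 3 (7 / 2) (25 / 48) K (35 * 2 ^ (K - 6)).
  apply: (bounded_le a1 2 2 0) => //; last by apply: P1 => //; rewrite le // leqnn.
  have /andP[_ l] := ln3564_bounds R; rewrite /density /a1 /a2 mul0r.
  move: (ln (35 / 64)) l => x l.
  have -> : 25 / 48 / (35 / 64) = 20 / 21 :> R by field.
  by lra.
have P2 : forall N, ~~ odd N -> (35 * 2 ^ (K - 6) <= N <= 48 * 2 ^ (K - 6))%N ->
    bounded a2 3 (7 / 2) (25 / 48) K N.
  apply: bounded_piece B2 => //; try lra.
  move=> N N4 cK /andP[_ NK]; rewrite -cK; apply: step_avg_le2 => //.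
  by rewrite cK pow2_64 //; move: NK; clear; lia.
have B3 : bounded a3 4 5 (13 / 12) K (48 * 2 ^ (K - 6)).
  apply: (bounded_le a2 3 (7 / 2) (25 / 48)) => //; last by apply: P2 => //; rewrite le // leqnn.
  have e : 48 / 64 = 3 / 4 :> R by field.
  have /andP[_ l] := ln34_bounds R; rewrite /density /a2 /a3 e.
  move: (ln (3 / 4)) l => x l.
  have -> : 25 / 48 / (3 / 4) = 25 / 36 :> R by field.
  have -> : 13 / 12 / (3 / 4) = 13 / 9 :> R by field.
  by lra.
have P3 : forall N, ~~ odd N -> (48 * 2 ^ (K - 6) <= N <= 57 * 2 ^ (K - 6))%N ->
    bounded a3 4 5 (13 / 12) K N.
  apply: bounded_piece B3 => //; try lra.
  move=> N N4 cK /andP[NK _]; rewrite -cK; apply: step_avg_le3 => //.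
  by rewrite cK pow2_64 //; move: NK; clear; lia.
have B4 : bounded a4 2 2 0 K (57 * 2 ^ (K - 6)).
  apply: (bounded_le a3 4 5 (13 / 12)) => //; last by apply: P3 => //; rewrite le // leqnn.
  have l := ln5764_ge R; rewrite /density /a3 /a4 mul0r.
  move: (ln (57 / 64)) l => x l.
  have -> : 13 / 12 / (57 / 64) = 208 / 171 :> R by field.
  by lra.
split=> //; apply: bounded_piece B4 => //; try lra.
by move=> N N4 cK _; have := step_avg_le1 R N N4; rewrite cK mul0r addr0.
Qed.

Lemma bounded_start (K : nat) : bounded a1 2 2 0 7 64 -> (6 < K)%N ->
  bounded a1 2 2 0 K (32 * 2 ^ (K - 6)).
Proof.
move=> B; elim: K => // K IH; rewrite ltnS leq_eqVlt => /predU1P[<- //|K6].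
have [_ _ _] := bounded_octave K K6 (IH K6); move=> /(_ (2 ^ K)%N).
have EK := esym (pow2_64 K K6).
rewrite EK leqnn -EK leq_mul2r orbT oddM /= => /(_ isT isT).
have -> : (32 * 2 ^ (K.+1 - 6) = 64 * 2 ^ (K - 6))%N.
  by rewrite subSn ?(ltnW K6) // expnS mulnA.
rewrite EK; move=> H; apply: le_trans H _; rewrite !lerD2r /potential natrX exprS.
have h0 := pow2_gt0 R K; move: (2 ^+ K) h0 => h h0.
have -> : h / h = 1 by rewrite divff // gt_eqF.
have -> : h / (2 * h) = 1 / 2 by field; rewrite gt_eqF.
have /andP[_ l] := ln12_bounds R; rewrite /density ln1 /a1 /a4 !mul0r -[K.+1%:R]natr1.
move: (ln (1 / 2)) l => x l.
(* The number [1.3862925] is [a4 / 2 - a1 - 1], so this is the gluing condition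
   [2 ln 2 >= a4 / 2 - a1 - 1] between octaves. *)
have : 0 <= h * (- 2 * x - (1 + (386 + (292 + 5 / 10) / 1000) / 1000)) by apply: mulr_ge0; lra.
by lra.
Qed.

(** With [N = p 2^K], the target is [K N + 2^K / 2 * (2 p lg p - 2 * 1.4034 p)]. It has the shape of
    a potential, so only the densities are compared. *)
Lemma potential_le (a al be ga : R) (N : nat) : (0 < N)%N ->
  density a al be ga (N%:R / 2 ^+ clg N) <=
    2 * (N%:R / 2 ^+ clg N) * lg (N%:R / 2 ^+ clg N) -
    2 * (1 + (403 + 4 / 10) / 1000) * (N%:R / 2 ^+ clg N) ->
  potential a al be ga (clg N) N%:R <=
    N%:R * lg N%:R - (1 + (403 + 4 / 10) / 1000) * N%:R.
Proof.
move=> N0; have h0 := pow2_gt0 R (clg N); have n0 : 0 < N%:R :> R by rewrite ltr0n.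
have l2 : ln (2 : R) != 0 by rewrite gt_eqF // ln_gt0 // ltr1n.
have -> : lg (N%:R / 2 ^+ clg N) = lg (N%:R : R) - (clg N)%:R.
  by rewrite /lg ln_div ?posrE // lnXn // -[ln 2 *+ _]mulr_natl mulrBl mulfK.
rewrite /potential; move: (2 ^+ clg N) h0 N%:R n0 (lg _) (clg N)%:R => h h0 n n0 L K.
move=> H.
have : h / 2 * density a al be ga (n / h) <= h / 2 *
    (2 * (n / h) * (L - K) - 2 * (1 + (403 + 4 / 10) / 1000) * (n / h)).
  by rewrite ler_wpM2l // divr_ge0 // ltW.
have -> : h / 2 * (2 * (n / h) * (L - K) - 2 * (1 + (403 + 4 / 10) / 1000) * (n / h)) =
  n * (L - K) - (1 + (403 + 4 / 10) / 1000) * n by field; rewrite gt_eqF.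
by move: (h / 2 * _) => u; lra.
Qed.

Lemma bounded_all (N : nat) : bounded a1 2 2 0 7 64 -> (64 < N)%N -> ~~ odd N ->
  complexity R N <= N%:R * lg N%:R - (1 + (403 + 4 / 10) / 1000) * N%:R +
    43 * ln (N%:R) + C.
Proof.
move=> B N64 oN; have N0 : (0 < N)%N by exact: leq_trans N64.
have [k [E /andP[kN Nk]]] := clg_bounds N (leq_trans (isT : (2 <= 65)%N) N64).
have K6 : (6 < clg N)%N.
  rewrite E ltnS leqNgt; apply/negP => k6.
  by have := leq_trans N64 (leq_trans Nk (leq_pexp2l (isT : (0 < 2)%N) k6)).
have [P1 P2 P3 P4] := bounded_octave _ K6 (bounded_start _ B K6).
have EK := pow2_64 _ K6.
have ge u : (u * 2 ^ (clg N - 6) <= N)%N -> u%:R / 64 <= N%:R / 2 ^+ clg N :> R.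
  move=> uN; rewrite ler_pdivlMr ?pow2_gt0 // mulrAC ler_pdivrMr //.
  rewrite -natrX EK -[64 in X in _ <= X]/(64%:R) -!natrM ler_nat.
  by move: uN; clear; lia.
have le u : (N <= u * 2 ^ (clg N - 6))%N -> N%:R / 2 ^+ clg N <= u%:R / 64 :> R.
  move=> uN; rewrite ler_pdivrMr ?pow2_gt0 // mulrAC ler_pdivlMr //.
  rewrite -natrX EK -[64 in X in X <= _]/(64%:R) -!natrM ler_nat.
  by move: uN; clear; lia.
have fin a al be ga : bounded a al be ga (clg N) N ->
    density a al be ga (N%:R / 2 ^+ clg N) <=
      2 * (N%:R / 2 ^+ clg N) * lg (N%:R / 2 ^+ clg N) -
      2 * (1 + (403 + 4 / 10) / 1000) * (N%:R / 2 ^+ clg N) ->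
    complexity R N <= N%:R * lg N%:R - (1 + (403 + 4 / 10) / 1000) * N%:R +
      43 * ln (N%:R) + C.
  by move=> HB Hd; apply: le_trans HB _; rewrite !lerD2r; exact: potential_le.
have N32 : (32 * 2 ^ (clg N - 6) <= N)%N.
  by move: EK kN; rewrite E expnS; clear; lia.
have Nu64 : (N <= 64 * 2 ^ (clg N - 6))%N by rewrite -EK E.
have [c1|/ltnW c1] := leqP N (35 * 2 ^ (clg N - 6)).
  apply: (fin a1 2 2 0); first by apply: P1; rewrite ?N32.
  apply: density_le1; last exact: (le 35).
  by have -> : 1 / 2 = 32%:R / 64 :> R by [field]; exact: ge.
have [c2|/ltnW c2] := leqP N (48 * 2 ^ (clg N - 6)).
  apply: (fin a2 3 (7 / 2) (25 / 48)); first by apply: P2; rewrite ?c1.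
  apply: density_le2; first exact: (ge 35).
  by have -> : 3 / 4 = 48%:R / 64 :> R by [field]; exact: le.
have [c3|/ltnW c3] := leqP N (57 * 2 ^ (clg N - 6)).
  apply: (fin a3 4 5 (13 / 12)); first by apply: P3; rewrite ?c2.
  apply: density_le3; last exact: (le 57).
  by have -> : 3 / 4 = 48%:R / 64 :> R by [field]; exact: ge.
apply: (fin a4 2 2 0); first by apply: P4; rewrite ?c3.
apply: density_le4; first exact: (ge 57).
by have := le 64%N Nu64; rewrite divff ?pnatr_eq0.
Qed.

End Potential.

Theorem theorem2 (R : realType) :
  exists C : R, forall n : nat, (2 <= n)%N -> ~~ odd n ->
    complexity R n <=
      n%:R * lg (n%:R : R) - (14034%:R / 10000%:R) * n%:R + C * lg (n%:R : R).
Proof.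
have -> : 14034%:R / 10000%:R = 1 + (403 + 4 / 10) / 1000 :> R.
  have -> : 14034%:R = 14 * 1000 + 34 :> R by rewrite -natrM -natrD.
  have -> : 10000%:R = 10 * 1000 :> R by rewrite -natrM.
  by field.
pose P := potential R (- (4 + (791 + 529 / 1000) / 1000)) 2 2 0 7 64.
(* Adding the absolute value of [P] makes the induction start at 64 whatever the sign of the
   potential there. *)
pose C0 := complexity R 64 + `|P|.
have c64 := complexity_ge0 R 64.
have C00 : 0 <= C0 by rewrite addr_ge0.
have l64 : 0 <= ln (64%:R : R) by rewrite ln_ge0 // ler1n.
(* [134] exceeds [43], the factor of [ln n] for [n > 64], and [1.4034 * 64], which bounds the
   negative term for [n <= 64]. *)
exists (134 + C0) => n n2 on.
have l2 : 1 / 2 < ln (2 : R).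
  by have /andP[_ l] := ln12_bounds R; rewrite ln2E; lra.
have l21 : ln (2 : R) < 1 by have /andP[l _] := ln12_bounds R; rewrite ln2E; lra.
have lgn : 1 <= lg (n%:R : R).
  rewrite /lg ler_pdivlMr ?mul1r; last by lra.
  by rewrite ler_ln ?posrE ?ltr0n ?ler_nat // (leq_trans _ n2).
have lnn : ln (n%:R : R) <= lg n%:R.
  have -> : ln (n%:R : R) = lg n%:R * ln 2 by rewrite /lg divfK // gt_eqF //; lra.
  by nra.
have [n64|n64] := ltnP 64 n.
  have B : bounded R C0 (- (4 + (791 + 529 / 1000) / 1000)) 2 2 0 7 64.
    have := ler_norm (- P); rewrite normrN /bounded /C0 -/P => h.
    lra.
  by have := bounded_all R C0 n B n64 on; nra.
have cn : complexity R n <= complexity R 64.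
  have [m E] : exists m, n = (2 * m).+2.
    exists (n./2.-1); have := odd_double_half n; rewrite (negPf on) add0n => {1}<-.
    by lia.
  rewrite E complexity_avg (complexity_avg R 31); apply: avg_le.
  by move: n64; rewrite E; clear; lia.
have P0 : 0 <= `|P| by [].
have nn : n%:R <= 64 :> R by rewrite ler_nat.
have n0 : 0 <= n%:R * lg (n%:R : R) by rewrite mulr_ge0 //; lra.
have : 134 + C0 <= (134 + C0) * lg (n%:R : R) by rewrite ler_peMr //; lra.
by rewrite /C0; lra.
Qed.
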